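(* Let $\mathfrak m=\sum_{i\in K}[a_i,b_i]$ be a multisegment and let $K=I\sqcup J$ be a partition such that $\{a_i:i\in I\}\cap\{a_j:j\in J\}=\varnothing$ and $\{b_i:i\in I\}\cap\{b_j:j\in J\}=\varnothing$. Put $\mathfrak m_I=\sum_{i\in I}[a_i,b_i]$ and $\mathfrak m_J=\sum_{j\in J}[a_j,b_j]$. If the irreducible component $C_{\mathfrak m}$ is rigid, then so are $C_{\mathfrak m_I}$ and $C_{\mathfrak m_J}$. If $C_{\mathfrak m}$ is pseudorigid, then so are $C_{\mathfrak m_I}$ and $C_{\mathfrak m_J}$.
   Context: Let $\Bbbk$ be an algebraically closed field of arbitrary characteristic. Let $Q$ be the equioriented quiver $1\to2\to\cdots\to N$ of type $A_N$. A segment is an interval $\Delta=[a,b]$ of integers with $1\le a\le b\le N$; $M(\Delta)$ is the representation of $Q$ with a one-dimensional space at each vertex of $[a,b]$, zero elsewhere, and nonzero maps along all arrows inside $[a,b]$. A multisegment is a formal sum $\mathfrak m=\sum_{i\in K}\Delta_i$ of segments over a finite index set $K$ (repetitions allowed), and $M(\mathfrak m)=\bigoplus_{i\in K}M(\Delta_i)$. For a finite-dimensional graded space $V=\bigoplus_{v=1}^N V_v$ put $R_Q(V)=\bigoplus_{v=1}^{N-1}\mathrm{Hom}(V_v,V_{v+1})$ and $G_V=\prod_v \mathrm{GL}(V_v)$. Lusztig's nilpotent variety $\Lambda(V)$ is the variety of pairs $(T,B)$ with $T_v:V_v\to V_{v+1}$, $B_v:V_{v+1}\to V_v$ satisfying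 $T_{v-1}B_{v-1}=B_vT_v$ on $V_v$ for $1\le v\le N$ (maps involving $V_0=V_{N+1}=0$ being zero); its points are the module structures on $V$ over the preprojective algebra $\Pi$ of $Q$ (nilpotency is automatic). For a multisegment $\mathfrak m$, with $V$ the graded space underlying $M(\mathfrak m)$, $C_{\mathfrak m}$ is the irreducible component of $\Lambda(V)$ obtained as the closure of the set of $(T,B)\in\Lambda(V)$ for which the representation $T$ is isomorphic to $M(\mathfrak m)$ (i.e. the closure of the conormal bundle of the $G_V$-orbit of $M(\mathfrak m)$ in $T^*(R_Q(V))$). An irreducible component $C$ is rigid if there is $x\in C$ with $\mathrm{Ext}^1_\Pi(x,x)=0$. It is pseudorigid if there are $x,y\in C$ with $\mathrm{Ext}^1_\Pi(x,y)=0$ (equivalently, this vanishing holds for a generic pair $(x,y)\in C\times C$). *)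

(* Defs.v *)
From HB Require Import structures.
From mathcomp Require Import all_boot all_order all_algebra.
From mathcomp Require Import mpoly.

Set Implicit Arguments.
Unset Strict Implicit.
Unset Printing Implicit Defensive.

Import GRing.Theory.
Local Open Scope ring_scope.

(* Conventions.  A graded space V is given by the dimensions of its pieces,    *)
(* V_v being the space of row vectors of length d v.  Linear maps are matrices *)
(* acting on the right, so composites read from left to right.  Vertices are   *)
(* natural numbers, with V_v = 0 unless 1 <= v <= N; every matrix that touches *)
(* such a V_v has no entries, hence is the zero map.                           *)

Record dimvec (N : nat) := DimVec {
  dimv :> nat -> nat;
  dimv_supp : forall v : nat, ~~ (1 <= v <= N)%N -> dimv v = 0%N
}.

Fact dimv0_supp (N v : nat) : ~~ (1 <= v <= N)%N -> 0%N = 0%N.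
Proof. by []. Qed.

Definition dimvec0 (N : nat) : dimvec N := DimVec (@dimv0_supp N).

Fact dimvD_supp (N : nat) (d e : dimvec N) (v : nat) :
  ~~ (1 <= v <= N)%N -> (d v + e v)%N = 0%N.
Proof. by move=> hv; rewrite !dimv_supp. Qed.

Definition dimvecD (N : nat) (d e : dimvec N) : dimvec N :=
  DimVec (@dimvD_supp N d e).

(* Segments [a, b] with 1 <= a <= b <= N. *)
Record segment (N : nat) := Segment {
  sbeg : 'I_N.+1;
  send : 'I_N.+1;
  segmentP : (1 <= sbeg <= send)%N
}.

Definition multisegment (N : nat) (K : finType) := K -> segment N.

Definition sub_multisegment (N : nat) (K : finType) (m : multisegment N K)
  (I : {set K}) : multisegment N {i : K | i \in I} := fun i => m (val i).
Arguments sub_multisegment {N K} m I _.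

Definition seg_mem (N : nat) (D : segment N) (v : nat) : bool :=
  (sbeg D <= v <= send D)%N.

Fact seg_supp (N : nat) (D : segment N) (v : nat) :
  ~~ (1 <= v <= N)%N -> nat_of_bool (seg_mem D v) = 0%N.
Proof.
apply: contraNeq; rewrite eqb0 negbK => /andP[av vb].
have /andP[a_gt0 _] := segmentP D.
by rewrite (leq_trans a_gt0 av) (leq_trans vb) // -ltnS ltn_ord.
Qed.

Definition seg_dim (N : nat) (D : segment N) : dimvec N :=
  DimVec (@seg_supp N D).

Section Representations.

Variables (k : fieldType) (N : nat).
Implicit Types c d e : dimvec N.

(* The space R_Q(V). *)
Definition RQ d := forall v : nat, 'M[k]_(d v, d v.+1).

Definition RQop d := forall v : nat, 'M[k]_(d v.+1, d v).

Record rep := Rep { rep_dim : dimvec N; rep_map : RQ rep_dim }.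

Definition rep0 : rep := @Rep (dimvec0 N) (fun=> 0).

Definition rep_dsum (M M' : rep) : rep :=
  @Rep (dimvecD (rep_dim M) (rep_dim M'))
    (fun v => block_mx (rep_map M v) 0 0 (rep_map M' v)).

Definition seg_rep (D : segment N) : rep :=
  @Rep (seg_dim D) (fun=> const_mx 1).

Definition multiseg_rep (K : finType) (m : multisegment N K) : rep :=
  \big[rep_dsum/rep0]_(i : K) seg_rep (m i).

Definition rep_iso d (S T : RQ d) : Prop :=
  exists g : forall v : nat, 'M[k]_(d v),
    (forall v, g v \in unitmx) /\
    (forall v, S v *m g v.+1 = g v *m T v).

(* The points of Lambda(V); [lam_rel v] is the relation at the vertex v.+1. *)
Record Lambda d := LambdaPoint {
  lamT : RQ d;
  lamB : RQop d;
  lam_rel : forall v : nat, lamB v *m lamT v = lamT v.+1 *m lamB v.+1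
}.

Definition is_hom d e (x : Lambda d) (y : Lambda e)
    (h : forall v : nat, 'M[k]_(d v, e v)) : Prop :=
  (forall v, lamT x v *m h v.+1 = h v *m lamT y v) /\
  (forall v, lamB x v *m h v = h v.+1 *m lamB y v).

(* 0 -> y -f-> z -g-> x -> 0 is a short exact sequence of modules over the     *)
(* preprojective algebra.                                                      *)
Definition is_extension d e c (x : Lambda d) (y : Lambda e) (z : Lambda c)
    (f : forall v : nat, 'M[k]_(e v, c v))
    (g : forall v : nat, 'M[k]_(c v, d v)) : Prop :=
  [/\ is_hom y z f, is_hom z x g &
      forall v, [/\ row_free (f v), row_full (g v)
                  & (f v == kermx (g v))%MS]].

Definition is_split d c (x : Lambda d) (z : Lambda c)
    (g : forall v : nat, 'M[k]_(c v, d v)) : Prop :=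
  exists s : forall v : nat, 'M[k]_(d v, c v),
    is_hom x z s /\ forall v, s v *m g v = 1%:M.

(* Ext^1(x, y) = 0 for Yoneda's Ext^1, whose elements are the classes of       *)
(* extensions of x by y and whose zero is the class of the split ones.         *)
Definition Ext1_eq0 d e (x : Lambda d) (y : Lambda e) : Prop :=
  forall c (z : Lambda c) f g, is_extension x y z f g -> is_split x z g.

(* Coordinates on R_Q(V) x R_Q(V)^*: the entries of the T_v and of the B_v.    *)
(* The omitted indices v >= N only concern matrices without entries.           *)
Definition coord d : finType :=
  ({v : 'I_N & ('I_(d v) * 'I_(d v.+1))%type} +
   {v : 'I_N & ('I_(d v.+1) * 'I_(d v))%type})%type.

Definition coord_val d (x : Lambda d) (t : coord d) : k :=
  match t with
  | inl (existT v (i, j)) => lamT x v i j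
  | inr (existT v (i, j)) => lamB x v i j
  end.

Definition peval d (p : {mpoly k[#|coord d|]}) (x : Lambda d) : k :=
  p.@[fun i => coord_val x (enum_val i)].

Definition Zariski_closed d (Z : Lambda d -> Prop) : Prop :=
  exists P : {mpoly k[#|coord d|]} -> Prop,
    forall x, Z x <-> (forall p, P p -> peval p x = 0).

Definition Zariski_closure d (S : Lambda d -> Prop) : Lambda d -> Prop :=
  fun x => forall Z, Zariski_closed Z -> (forall y, S y -> Z y) -> Z x.

Definition component (K : finType) (m : multisegment N K) :
    Lambda (rep_dim (multiseg_rep m)) -> Prop :=
  Zariski_closure (fun x => rep_iso (lamT x) (rep_map (multiseg_rep m))).

Definition rigid d (C : Lambda d -> Prop) : Prop :=
  exists x, C x /\ Ext1_eq0 x x.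

Definition pseudorigid d (C : Lambda d -> Prop) : Prop :=
  exists x y, [/\ C x, C y & Ext1_eq0 x y].

End Representations.

Arguments component k {N K} m _.

(* Main.v *)
Require Import Defs.
From HB Require Import structures.
From mathcomp Require Import all_boot all_order all_algebra.
From mathcomp Require Import mpoly zify ring.
From Stdlib Require Import Classical_Prop.

(** Over the preprojective algebra, the vanishing of Ext^1(x, y) for
    x = (T, B) and y = (T', B') means that two maps are onto: the map
    h |-> h B' - B h from the T-linear maps h : V -> V' to the T-linear maps
    that lower the grading by one, and the same map with x and y exchanged
    (Ext1_eq0_bracket, by trace duality).  The vanishing of Ext^1 is an open
    condition, so a rigid or pseudorigid component already has witnesses whose
    T is isomorphic to M(m) (Ext1_eq0_open).

    For such x, choose a basis of V adapted to the segments [a_i, b_i].  Linear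
    maps between segments are unique up to a scalar, so a T-linear map becomes
    a matrix supported on { (i, j) : a_j <= a_i, b_j <= b_i }, and B becomes a
    matrix supported on the positions where both inequalities are strict.  The
    former matrices form an algebra A and the latter a nilpotent ideal N of A.
    Entries at positions with a_i > b_j + 1 correspond to zero maps; they form
    an ideal R of A, and Ext^1 = 0 becomes the surjectivity of
    eta |-> eta c' - c eta from A to N modulo R, for the matrices c and c' of
    B and B', and of the same map with c and c' exchanged (framed_bracket).

    It remains to pass from m to a set of indices p that shares no left end and
    no right end with its complement.  Let D be the diagonal 0/1 matrix of p.
    As no end is shared, [eta, D] lies in N for every eta in A, so D + t c acts
    by commutators from A to N just as c does.  Surjectivity is open, so it
    persists for D + t c and D + t c' with t generic
    (surjective_commutator_deform).  But D is semisimple and c nilpotent: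
    because D separates p from its complement, D + t c is conjugate under 1 + N
    to D + c1 where c1 in N commutes with D, that is, c1 is block diagonal
    (block_diagonalize).  For block diagonal matrices the commutator map splits
    into blocks, D drops out of the p-block, and there remains the surjectivity
    statement for the p-blocks of c1 and c1' (surjective_commutator_corner).
    These are the matrices of points over m_p without extensions.  Surjectivity
    for c and c' does not pass directly to their p-blocks, because the p-block of
    eta c' - c eta also contains products of entries that lead out of p and
    back. *)

Set Implicit Arguments.
Unset Strict Implicit.
Unset Printing Implicit Defensive.

Import GRing.Theory.
Local Open Scope ring_scope.

(** * Idempotents, nilpotents and supports of matrices *)

Section NilpotentIdempotent.
Variable R : pzRingType.
Implicit Types c e u : R.

(** An element c that is idempotent up to a nilpotent has its spectrum in
    {0, 1};
    the polynomial 1 - (1 - X^L)^L vanishes to order L at 0 and takes the value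
    1 to order L at 1, so it sends c to the spectral projection for 1. *)
Lemma nilp_idempotent_lift c L : (c * (1 - c)) ^+ L = 0 ->
  let e := 1 - (1 - c ^+ L) ^+ L in e * e = e /\ GRing.comm c e.
Proof.
move=> c_nil e.
have cc1 : GRing.comm c (1 - c) by apply: commrB; [apply: commr1|].
have cu : GRing.comm c (1 - c ^+ L) by apply: commrB; [apply: commr1|apply: commrX].
have ce : GRing.comm c e by apply: commrB; [apply: commr1|apply: commrX].
split=> //; suff ee : e * (1 - e) = 0.
  by apply/eqP; rewrite eq_sym -subr_eq0 -[X in X - _]mulr1 -mulrBr ee.
have -> : 1 - e = (1 - c ^+ L) ^+ L by rewrite /e opprB addrC subrK.
have eE : e = c ^+ L * \sum_(i < L) (1 - c ^+ L) ^+ i.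
  rewrite /e -[X in X - _ = _](expr1n _ L) subrXX_comm; last exact/commr_sym/commr1.
  rewrite opprB addrC subrK; congr (_ * _).
  by apply: eq_bigr => i _; rewrite expr1n mul1r.
have c1E : 1 - c ^+ L = (1 - c) * \sum_(i < L) c ^+ i.
  rewrite -[X in X - _ = _](expr1n _ L) subrXX_comm; last exact/commr_sym/commr1.
  by congr (_ * _); apply: eq_bigr => i _; rewrite expr1n mul1r.
have csum : GRing.comm (1 - c) (\sum_(i < L) c ^+ i).
  by apply: commr_sum => i _; apply: commrX; apply: commr_sym.
have usum : GRing.comm (\sum_(i < L) (1 - c ^+ L) ^+ i) ((1 - c) ^+ L).
  apply: commrX; apply: commr_sym; apply: commr_sum => i _; apply: commrX.
  by apply: commrB; [apply: commr1|apply/commrX/commr_sym].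
rewrite eE {2}c1E exprMn_comm // mulrA -(mulrA (c ^+ L)) usum mulrA.
by rewrite -exprMn_comm // c_nil !mul0r.
Qed.

Lemma nilp_unit u L : u ^+ L = 0 ->
  let s := \sum_(i < L) u ^+ i in (1 - u) * s = 1 /\ s * (1 - u) = 1.
Proof.
move=> u_nil s.
have us : GRing.comm (1 - u) s.
  apply: commr_sum => i _; apply: commrX; apply: commr_sym.
  by apply: commrB; [apply: commr1|].
suff e : (1 - u) * s = 1 by rewrite -us.
rewrite -[RHS]subr0 -u_nil -[X in _ = X - _](expr1n _ L).
rewrite subrXX_comm; last exact/commr_sym/commr1.
by congr (_ * _); apply: eq_bigr => i _; rewrite expr1n mul1r.
Qed.

End NilpotentIdempotent.

Section Support.
Variables (k : pzRingType) (n : nat).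
Implicit Types (r : rel 'I_n) (M : 'M[k]_n).

Definition supp r M := forall i j, ~~ r i j -> M i j = 0.

Lemma supp0 r : supp r 0. Proof. by move=> i j _; rewrite mxE. Qed.

Lemma supp_add r M M' : supp r M -> supp r M' -> supp r (M + M').
Proof. by move=> hM hM' i j rij; rewrite mxE hM ?hM' ?addr0. Qed.

Lemma supp_opp r M : supp r M -> supp r (- M).
Proof. by move=> hM i j rij; rewrite mxE hM ?oppr0. Qed.

Lemma supp_sub r M M' : supp r M -> supp r M' -> supp r (M - M').
Proof. by move=> hM hM'; apply/supp_add/supp_opp. Qed.

Lemma supp_scale r a M : supp r M -> supp r (a *: M).
Proof. by move=> hM i j rij; rewrite mxE hM ?mulr0. Qed.

Lemma supp_sum r m (F : 'I_m -> 'M[k]_n) :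
  (forall l, supp r (F l)) -> supp r (\sum_(l < m) F l).
Proof. by move=> hF; elim/big_ind: _ => //; [apply: supp0|apply: supp_add]. Qed.

Lemma suppS r1 r2 M : subrel r1 r2 -> supp r1 M -> supp r2 M.
Proof. by move=> s hM i j; move/(contra (s i j))/hM. Qed.

Lemma supp_mul r1 r2 r3 M M' :
    (forall i l j, r1 i l -> r2 l j -> r3 i j) ->
  supp r1 M -> supp r2 M' -> supp r3 (M *m M').
Proof.
move=> h hM hM' i j rij; rewrite mxE big1 // => l _.
have [ril|/hM->] := boolP (r1 i l); last by rewrite mul0r.
have [rlj|/hM'->] := boolP (r2 l j); last by rewrite mulr0.
by rewrite (h _ _ _ ril rlj) in rij.
Qed.

Lemma supp_diag r (p : pred 'I_n) : (forall i, p i -> r i i) ->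
  supp r (diag_mx (\row_i (p i)%:R)).
Proof.
move=> hp i j rij; rewrite !mxE; case: eqP => [eij|]; last by rewrite mulr0n.
by subst j; rewrite (negPf (contra (hp i) rij)).
Qed.

Lemma supp1 r : reflexive r -> supp r 1%:M.
Proof.
move=> rr i j rij; rewrite mxE; case: eqP => // eij.
by rewrite eij rr in rij.
Qed.

Definition indicator_mx (p : pred 'I_n) : 'M[k]_n := diag_mx (\row_i (p i)%:R).

Lemma indicator_mxE (p : pred 'I_n) i j : indicator_mx p i j = ((i == j) && p i)%:R.
Proof. by rewrite !mxE; case: (i == j). Qed.

Lemma indicator_mul (p : pred 'I_n) (M : 'M[k]_n) i j :
  (indicator_mx p *m M) i j = (p i)%:R * M i j.
Proof. by rewrite mul_diag_mx !mxE. Qed.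

Lemma mul_indicator (p : pred 'I_n) (M : 'M[k]_n) i j :
  (M *m indicator_mx p) i j = M i j * (p j)%:R.
Proof. by rewrite mul_mx_diag !mxE. Qed.

Lemma indicator_idem (p : pred 'I_n) : indicator_mx p *m indicator_mx p = indicator_mx p.
Proof.
apply/matrixP=> i j; rewrite indicator_mul indicator_mxE.
by case: (p i); rewrite ?mul1r ?mul0r ?andbF ?andbT.
Qed.

Definition restrict r M := \matrix_(i, j) if r i j then M i j else 0.

Lemma supp_restrict r M : supp r (restrict r M).
Proof. by move=> i j /negPf rij; rewrite mxE rij. Qed.

Lemma restrict_id r M : supp r M -> restrict r M = M.
Proof.
by move=> hM; apply/matrixP=> i j; rewrite mxE; case: ifPn => // /hM.
Qed.

End Support.

(** Openness of surjectivity along a line: P <= A0 persists for A1 + t A0 as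
    soon as t is not a root of a characteristic polynomial.  Two families are
    treated together because both must be kept for the same t. *)
Lemma generic_rowspace (k : closedFieldType) q p (P : 'M[k]_q)
    (A0 A1 B0 B1 : 'M[k]_(p, q)) :
    (P <= A0)%MS -> (P <= B0)%MS -> A1 = A1 *m P -> B1 = B1 *m P ->
  exists t : k, (P <= (A1 + t *: A0)%R)%MS /\ (P <= (B1 + t *: B0)%R)%MS.
Proof.
move=> /submxP[C PC] /submxP[C' PC'] eA eB.
have step (E0 E1 : 'M[k]_(p, q)) F t : P = F *m E0 -> E1 = E1 *m P ->
    ~~ root (char_poly (- (F *m E1))) t -> (P <= (E1 + t *: E0)%R)%MS.
  move=> eP eE1 rt.
  have u : t%:M + F *m E1 \in unitmx.
    rewrite -row_free_unit -kermx_eq0; move: rt; rewrite -eigenvalue_root_char.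
    rewrite /eigenvalue negbK /eigenspace => /eqP e; apply/eqP.
    move/(congr1 (mulmx 1%:M)): e; rewrite mul1mx.
    have -> : - (F *m E1) - t%:M = - (t%:M + F *m E1) by rewrite opprD addrC.
    rewrite mulmx0 => e; apply/eqP; rewrite -submx0 -e sub_kermx mulmxN oppr_eq0.
    by rewrite mulmx_ker.
  apply/submxP; exists (invmx (t%:M + F *m E1) *m F).
  suff e : F *m (E1 + t *: E0) = (t%:M + F *m E1) *m P.
    by rewrite -mulmxA e mulKmx.
  by rewrite mulmxDr -scalemxAr -eP mulmxDl mul_scalar_mx -mulmxA -eE1 addrC.
have : char_poly (- (C *m A1)) * char_poly (- (C' *m B1)) != 0.
  by rewrite mulf_neq0 ?monic_neq0 ?char_poly_monic.
case/closed_nonrootP=> t; rewrite rootM negb_or => /andP[r1 r2].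
by exists t; split; apply: step; eauto.
Qed.

(** * The deformation argument for commutators *)

Section SegmentOrder.
Variables (n : nat) (a b : 'I_n -> nat).
Implicit Type p : pred 'I_n.

(** The positions (i, j) in p x p where seg_le holds contain those of the nonzero
    maps from the segment [a i, b i] to [a j, b j]; seg_lt plays the same role
    for the maps that lower the grading by one. *)
Definition seg_le p (i j : 'I_n) := [&& p i, p j, a j <= a i & b j <= b i]%N.
Definition seg_lt p (i j : 'I_n) := [&& p i, p j, a j < a i & b j < b i]%N.

Lemma seg_ltW p : subrel (seg_lt p) (seg_le p).
Proof. by move=> i j /and4P[pi pj h h']; rewrite /seg_le pi pj (ltnW h) (ltnW h'). Qed.

Lemma seg_le_trans p i l j : seg_le p i l -> seg_le p l j -> seg_le p i j.
Proof.
move=> /and4P[pi _ h1 h2] /and4P[_ pj h3 h4].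
by rewrite /seg_le pi pj (leq_trans h3) ?(leq_trans h4).
Qed.

Lemma seg_le_lt_trans p i l j : seg_le p i l -> seg_lt p l j -> seg_lt p i j.
Proof.
move=> /and4P[pi _ h1 h2] /and4P[_ pj h3 h4].
by rewrite /seg_lt pi pj (leq_trans h3) ?(leq_trans h4).
Qed.

Lemma seg_lt_le_trans p i l j : seg_lt p i l -> seg_le p l j -> seg_lt p i j.
Proof.
move=> /and4P[pi _ h1 h2] /and4P[_ pj h3 h4].
by rewrite /seg_lt pi pj (leq_ltn_trans h3) ?(leq_ltn_trans h4).
Qed.

Lemma seg_le_refl : reflexive (seg_le predT).
Proof. by move=> i; rewrite /seg_le /= !leqnn. Qed.

End SegmentOrder.

Section Deformation.
Variables (k : closedFieldType) (n : nat) (a b : 'I_n -> nat).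
Implicit Types (p : pred 'I_n) (c eta xi : 'M[k]_n).

Let le := seg_le a b.
Let lt := seg_lt a b.

(** A morphism from [a i, b i] to [a j, b j] that lowers the grading by one is
    forced to be zero when a i > b j + 1, whence the restriction on the positions
    at which the equation is imposed. *)
Definition surjective_commutator p c c' :=
  forall xi, supp (lt p) xi -> exists2 eta, supp (le p) eta &
    forall i j, lt p i j -> (a i <= (b j).+1)%N ->
      (eta *m c' - c *m eta) i j = xi i j.

Lemma supp_indicator p : supp (le predT) (indicator_mx k p).
Proof. by apply: supp_diag => i _; apply: seg_le_refl. Qed.

Local Notation suppA := (supp (le predT)).
Local Notation suppN := (supp (lt predT)).

Lemma suppA_mul c c' : suppA c -> suppA c' -> suppA (c *m c').
Proof. by apply: supp_mul => i l j; apply: seg_le_trans. Qed.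

Lemma suppN_mulr c c' : suppA c -> suppN c' -> suppN (c *m c').
Proof. by apply: supp_mul => i l j; apply: seg_le_lt_trans. Qed.

Lemma suppN_mull c c' : suppN c -> suppA c' -> suppN (c *m c').
Proof. by apply: supp_mul => i l j; apply: seg_lt_le_trans. Qed.

Lemma suppNA c : suppN c -> suppA c.
Proof. by apply: suppS; apply: seg_ltW. Qed.

Lemma suppA1 : suppA (1%:M : 'M[k]_n).
Proof. by apply/supp1/seg_le_refl. Qed.

Lemma suppA_congr e c : suppA e -> suppN (c - e) -> suppA c.
Proof. by move=> he /suppNA hc; rewrite -(subrK e c); apply: supp_add. Qed.

Lemma suppN_mul_congr c1 e1 c2 e2 : suppA e1 -> suppA e2 ->
  suppN (c1 - e1) -> suppN (c2 - e2) -> suppN (c1 *m c2 - e1 *m e2).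
Proof.
move=> A1 A2 h1 h2.
have -> : c1 *m c2 - e1 *m e2 = c1 *m (c2 - e2) + (c1 - e1) *m e2.
  by rewrite mulmxBr mulmxBl addrA subrK.
apply: supp_add; [apply: suppN_mulr => //; exact: suppA_congr h1|].
exact: suppN_mull.
Qed.

Lemma suppN_exp_congr c e L : suppA e -> e *m e = e ->
  suppN (c - e) -> suppN (c ^+ L.+1 - e).
Proof.
move=> Ae ee h; elim: L => [|L IH]; first by rewrite expr1.
by rewrite exprS -[X in _ - X]ee; apply: suppN_mul_congr.
Qed.

(** Each factor in N raises the gap between the left ends by at least one. *)
Lemma suppN_nilpotent L c : (forall i, a i < L)%N -> suppN c -> c ^+ L = 0.
Proof.
move=> aL hc.
have h m : supp (fun i j => a j + m <= a i)%N (c ^+ m).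
  elim: m => [|m IH]; first by apply: supp1 => i; rewrite addn0.
  rewrite exprS; apply: supp_mul hc IH => i l j /and4P[_ _ h _].
  by move=> /= h'; rewrite addnS; apply: leq_ltn_trans h' h.
apply/matrixP=> i j; rewrite h ?mxE // -ltnNge.
by rewrite (leq_trans (aL i)) ?leq_addl.
Qed.

Section BlockDiagonalization.
Variables (p : pred 'I_n) (L : nat) (aL : forall i, (a i <= L)%N).
Let D := indicator_mx k p.

(** The spectral projection E of D + c for the eigenvalue 1 is congruent to D
    modulo N, so g := D E + (1 - D)(1 - E) is congruent to 1; it satisfies
    g E = D g, so that conjugation by g turns E into D, and D + c, which commutes
    with E, into a matrix that commutes with D. *)
Lemma block_diagonalize c : suppN c ->
  exists g g' c1, [/\ g *m g' = 1%:M, g' *m g = 1%:M, suppA g /\ suppA g',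
    suppN c1 & D *m c1 = c1 *m D /\ g *m (D + c) = (D + c1) *m g].
Proof.
move=> Nc; pose C := D + c.
have AD : suppA D := supp_indicator p.
have DD : D *m D = D := indicator_idem k p.
have A1 := suppA1.
have AD1 : suppA (1%:M - D) by apply: supp_sub.
have D1D1 : (1%:M - D) *m (1%:M - D) = 1%:M - D.
  by rewrite mulmxBr mulmx1 mulmxBl mul1mx DD subrr subr0.
have D1D : (1%:M - D) *m D = 0 by rewrite mulmxBl mul1mx DD subrr.
have DD1 : D *m (1%:M - D) = 0 by rewrite mulmxBr mulmx1 DD subrr.
have NC : suppN (C - D) by rewrite /C addrC addKr.
have compl (x e : 'M[k]_n) : suppN (x - e) -> suppN (1%:M - x - (1%:M - e)).
  move=> h; have -> : 1%:M - x - (1%:M - e) = - (x - e).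
    by rewrite opprB addrC addrA subrK opprB.
  exact: supp_opp.
have nilC : (C * (1 - C)) ^+ L.+1 = 0.
  apply: suppN_nilpotent => //.
  have := suppN_mul_congr AD AD1 NC (compl _ _ NC).
  by rewrite DD1 subr0.
have [] := nilp_idempotent_lift nilC.
set E := 1 - _ => EE CE.
have NE : suppN (E - D).
  have -> : E - D = 1 - (1 - C ^+ L.+1) ^+ L.+1 - (1%:M - (1%:M - D)).
    by rewrite subKr.
  apply/compl/suppN_exp_congr => //; apply: compl.
  exact: suppN_exp_congr.
clearbody E; have {}EE : E *m E = E := EE; have {}CE : C *m E = E *m C := CE.
pose g := D *m E + (1%:M - D) *m (1%:M - E).
have gE : g *m E = D *m g.
  rewrite /g mulmxDl [D *m (_ + _)]mulmxDr -!mulmxA EE [(1%:M - E) *m E]mulmxBl mul1mx EE.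
  by rewrite subrr mulmx0 !mulmxA DD DD1 mul0mx.
pose u := 1%:M - g.
have Nu : suppN u.
  have -> : u = - (D *m E - D *m D + ((1%:M - D) *m (1%:M - E) - (1%:M - D) *m (1%:M - D))).
    rewrite DD D1D1 /u /g addrACA -opprD opprB.
    by rewrite [D + _]addrC subrK.
  apply/supp_opp/supp_add; apply: suppN_mul_congr => //; try exact: compl.
    by rewrite subrr; apply: supp0.
  by rewrite subrr; apply: supp0.
have Au i : suppA (u ^+ i).
  elim: i => [//|i IH]; rewrite exprS; apply: suppA_mul => //; exact: suppNA.
have [] := nilp_unit (suppN_nilpotent (aL : forall i, a i < L.+1)%N Nu).
set g' := \sum_(i < _) _; rewrite subKr => gg' g'g.
have {}gg' : g *m g' = 1%:M := gg'; have {}g'g : g' *m g = 1%:M := g'g.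
have Ag : suppA g by rewrite -[g](subKr 1%:M); apply: supp_sub => //; apply: suppNA.
have Ag' : suppA g' by apply: supp_sum => i; apply: Au.
have Eg' : E *m g' = g' *m D.
  by rewrite -[E]mul1mx -g'g -!mulmxA (mulmxA g E) gE -(mulmxA D) gg' mulmx1.
pose C1 := g *m C *m g'.
have DC1 : D *m C1 = C1 *m D.
  by rewrite /C1 -[in RHS]mulmxA -Eg' !mulmxA -gE -!(mulmxA g) CE.
exists g, g', (C1 - D); split=> //.
  have -> : C1 - D = g *m C *m g' - 1%:M *m D *m 1%:M by rewrite mul1mx mulmx1.
  apply: suppN_mul_congr => //; first exact: suppA_mul.
    apply: suppN_mul_congr => //.
    have -> : g - 1%:M = - u by rewrite opprB.
    exact: supp_opp.
  rewrite /g' big_ord_recl /= expr0 addrC addKr.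
  apply: supp_sum => i; rewrite exprS; apply: suppN_mull => //; exact: Au.
split; first by rewrite mulmxBr mulmxBl DC1.
by rewrite [D + (_ - _)]addrC subrK /C1 -mulmxA g'g mulmx1.
Qed.
End BlockDiagonalization.

Lemma mul_lin_mx q1 q2 r1 r2 (f : 'M[k]_(q1, q2) -> 'M[k]_(r1, r2)) M :
  linear f -> mxvec M *m lin_mx f = mxvec (f M).
Proof.
move=> lf; pose F : {linear _ -> _} :=
  HB.pack f (GRing.isLinear.Build _ _ _ _ _ lf).
exact: (mul_vec_lin F M).
Qed.

Let target i j := lt predT i j && (a i <= (b j).+1)%N.
Let comm c c' eta :=
  restrict target (restrict (le predT) eta *m c' - c *m restrict (le predT) eta).

Lemma restrict_linear r : linear (@restrict k n r).
Proof.
move=> t M M'; apply/matrixP=> i j; rewrite !mxE.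
by case: ifP; rewrite // mulr0 addr0.
Qed.

Lemma comm_linear c c' : linear (comm c c').
Proof.
move=> t M M'; rewrite /comm restrict_linear mulmxDl mulmxDr.
rewrite -scalemxAl -scalemxAr opprD addrACA -scalerN -scalerDr.
exact: restrict_linear.
Qed.

Lemma surjective_commutatorP c c' : surjective_commutator predT c c' <->
  (lin_mx (restrict target) <= lin_mx (comm c c'))%MS.
Proof.
have lr := @restrict_linear target; have lc := comm_linear c c'.
split=> [sc|/submxP[C eC] xi Nxi].
  apply/row_subP=> s; rewrite rowE -[delta_mx _ _]vec_mxK mul_lin_mx //.
  set M := vec_mx _.
  have [|eta Aeta eq_eta] := sc (restrict target M).
    by apply: suppS (@supp_restrict _ _ _ _) => i j /andP[].
  suff -> : restrict target M = comm c c' eta by rewrite -mul_lin_mx ?submxMl.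
  apply/matrixP=> i j; rewrite /comm (restrict_id Aeta) [in RHS]mxE.
  by case: ifPn => [/andP[lij tij]|/supp_restrict->//]; rewrite eq_eta.
exists (restrict (le predT) (vec_mx (mxvec xi *m C))).
  exact: supp_restrict.
move=> i j lij tij; have := mul_lin_mx xi lr.
rewrite eC mulmxA -[mxvec xi *m C]vec_mxK mul_lin_mx //.
move=> /(can_inj mxvecK)/matrixP/(_ i j).
by rewrite [in LHS]mxE [in RHS]mxE /target lij tij vec_mxK.
Qed.

Variable p : pred 'I_n.
Hypothesis apart : forall i j, p i -> ~~ p j -> a i != a j /\ b i != b j.
Let D := indicator_mx k p.

(** The entry of the commutator at (i, j) is nonzero only if exactly one of i, j
    is in p, and then neither end of the two segments is shared, so that the
    inequalities between their ends are strict. *)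
Lemma indicator_commutator eta : suppA eta -> suppN (eta *m D - D *m eta).
Proof.
move=> Aeta i j nlt; rewrite mxE [X in _ + X]mxE mul_indicator indicator_mul.
have [lij|/Aeta->] := boolP (le predT i j); last by rewrite mul0r mulr0 subrr.
case pi: (p i); case pj: (p j); rewrite ?mulr0 ?mul0r ?mulr1 ?mul1r ?subrr //.
  have [] := apart pi (negbT pj); move: lij nlt; rewrite /le /lt /seg_le /seg_lt /=; lia.
have [] := apart pj (negbT pi); move: lij nlt; rewrite /le /lt /seg_le /seg_lt /=; lia.
Qed.

(** The commutator map of D + t c is that of D plus t times that of c, and it
    still takes its values in N; hence surjectivity for c gives surjectivity
    for generic t. *)
Lemma surjective_commutator_deform c c' :
    surjective_commutator predT c c' -> surjective_commutator predT c' c ->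
  exists t : k, surjective_commutator predT (D + t *: c) (D + t *: c') /\
                surjective_commutator predT (D + t *: c') (D + t *: c).
Proof.
have commD e e' t : lin_mx (comm (D + t *: e) (D + t *: e')) =
    lin_mx (comm D D) + t *: lin_mx (comm e e').
  apply/row_matrixP=> s; rewrite linearD linearZ /= !rowE.
  rewrite -[delta_mx _ _]vec_mxK !mul_lin_mx; try exact: comm_linear.
  rewrite /comm; set M := restrict (le predT) _; rewrite -linearZ -linearD /=; congr mxvec.
  rewrite [RHS]addrC -restrict_linear; congr restrict.
  rewrite mulmxDr mulmxDl -scalemxAl -scalemxAr opprD addrACA addrC.
  by rewrite scalerBr.
have commP : lin_mx (comm D D) = lin_mx (comm D D) *m lin_mx (restrict target).
  apply/row_matrixP=> s; rewrite row_mul !rowE -[delta_mx _ _]vec_mxK.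
  rewrite mul_lin_mx; last exact: comm_linear.
  rewrite mul_lin_mx; last exact: restrict_linear.
  by rewrite [in RHS]restrict_id //; apply: supp_restrict.
move=> /surjective_commutatorP s1 /surjective_commutatorP s2.
have [t [h1 h2]] := generic_rowspace s1 s2 commP commP.
by exists t; split; apply/surjective_commutatorP; rewrite commD.
Qed.

(** Conjugation preserves the ideal N and the ideal of positions that do not
    count, so surjectivity depends only on the conjugacy classes under units of
    the algebra A; the two matrices may be conjugated independently. *)
Lemma surjective_commutator_conj c c' c1 c1' g h g' h' :
    g *m g' = 1%:M -> g' *m g = 1%:M -> h *m h' = 1%:M -> h' *m h = 1%:M ->
    suppA g -> suppA g' -> suppA h -> suppA h' ->
    suppN c -> suppN c' ->
    g *m (D + c) = (D + c1) *m g -> h *m (D + c') = (D + c1') *m h ->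
  surjective_commutator predT (D + c) (D + c') ->
  surjective_commutator predT (D + c1) (D + c1').
Proof.
move=> gg' g'g hh' h'h Ag Ag' Ah Ah' Nc Nc' eg eh sc xi Nxi.
have [|eta Aeta eq_eta] := sc (g' *m xi *m h).
  exact/suppN_mull/Ah/suppN_mulr.
exists (g *m eta *m h'); first by apply: suppA_mul => //; apply: suppA_mul.
pose w := eta *m (D + c') - (D + c) *m eta - g' *m xi *m h.
have Nw : suppN w.
  apply: supp_sub; last exact/suppN_mull/Ah/suppN_mulr.
  have -> : eta *m (D + c') - (D + c) *m eta =
            (eta *m D - D *m eta) + (eta *m c' - c *m eta).
    by rewrite mulmxDr mulmxDl opprD addrACA.
  apply/supp_add/supp_sub; [exact: indicator_commutator|exact: suppN_mulr|exact: suppN_mull].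
(* the positions on which no condition is imposed form an ideal *)
pose far i j := lt predT i j && ((b j).+1 < a i)%N.
have Fw : supp far w.
  move=> i j; rewrite negb_and -leqNgt => /orP[/Nw //|tij].
  have [lij|/Nw //] := boolP (lt predT i j).
  by rewrite /w mxE [X in _ + X]mxE eq_eta // subrr.
have -> : g *m eta *m h' *m (D + c1') - (D + c1) *m (g *m eta *m h') =
    xi + g *m w *m h'.
  have eh' : h' *m (D + c1') = (D + c') *m h'.
    by rewrite -[D + c1']mulmx1 -hh' (mulmxA (D + c1')) -eh !mulmxA h'h mul1mx.
  rewrite /w !mulmxBr !mulmxBl !mulmxA gg' mul1mx -(mulmxA xi) hh' mulmx1.
  by rewrite [RHS]addrC subrK -eg -(mulmxA _ h') eh' !mulmxA.
move=> i j lij tij; rewrite mxE.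
suff -> : (g *m w *m h') i j = 0 by rewrite addr0.
have Fgwh : supp far (g *m w *m h').
  apply: (@supp_mul _ _ far (le predT)) Ah' => [x l y|].
    move=> /andP[/and4P[_ _ ? ?] ?] /and4P[_ _ ? ?].
    rewrite /far /lt /seg_lt /=; lia.
  apply: (@supp_mul _ _ (le predT) far) Ag Fw => x l y.
  move=> /and4P[_ _ ? ?] /andP[/and4P[_ _ ? ?] ?].
  rewrite /far /lt /seg_lt /=; lia.
by apply: Fgwh; rewrite negb_and -leqNgt tij orbT.
Qed.

(** When everything in sight commutes with D, the equation splits into blocks,
    and on the block of p the two contributions of D cancel. *)
Lemma surjective_commutator_corner c c' : D *m c = c *m D -> D *m c' = c' *m D ->
    surjective_commutator predT (D + c) (D + c') ->
  surjective_commutator p (D *m c *m D) (D *m c' *m D).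
Proof.
move=> Dc Dc' sc xi pxi.
have DD : D *m D = D := indicator_idem k p.
have lpT i j : lt p i j -> lt predT i j by case/and4P=> _ _ ? ?; apply/and4P.
have [|eta Aeta eq_eta] := sc xi; first exact: suppS pxi.
exists (D *m eta *m D).
  move=> i j; rewrite mul_indicator indicator_mul.
  case pi: (p i); case pj: (p j); rewrite ?mul0r ?mulr0 // mul1r mulr1 => lij.
  by apply: Aeta; move: lij; rewrite /le /seg_le pi pj.
move=> i j lij tij; have /and4P[pi pj _ _] := lij.
rewrite -eq_eta //; last exact: lpT.
have cornerE e : D *m e = e *m D -> D *m e *m D = D *m e.
  by move=> De; rewrite -mulmxA -De mulmxA DD.
have e1 : D *m eta *m D *m (D *m c' *m D) = D *m (eta *m c') *m D.
  rewrite (cornerE _ Dc') !mulmxA -(mulmxA (D *m eta) D D) DD.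
  by rewrite -(mulmxA (D *m eta) D c') Dc' mulmxA.
have e2 : D *m c *m D *m (D *m eta *m D) = D *m (c *m eta) *m D.
  by rewrite (cornerE _ Dc) Dc !mulmxA -(mulmxA c D D) DD -Dc.
have e3 : D *m (eta *m D) *m D = D *m (D *m eta) *m D.
  by rewrite !mulmxA DD -mulmxA DD.
have -> : D *m eta *m D *m (D *m c' *m D) - D *m c *m D *m (D *m eta *m D) =
    D *m (eta *m (D + c') - (D + c) *m eta) *m D.
  rewrite e1 e2 [eta *m (D + c')]mulmxDr [(D + c) *m eta]mulmxDl opprD addrACA.
  rewrite [D *m (_ + _)]mulmxDr mulmxDl.
  by rewrite !mulmxBr !mulmxBl e3 subrr add0r.
by rewrite mul_indicator indicator_mul pi pj mul1r mulr1.
Qed.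

Lemma supp_corner c : suppN c -> supp (lt p) (D *m c *m D).
Proof.
move=> Nc i j; rewrite mul_indicator indicator_mul.
case pi: (p i); case pj: (p j); rewrite ?mul0r ?mulr0 // mul1r mulr1 => lij.
by apply: Nc; move: lij; rewrite /lt /seg_lt pi pj.
Qed.

(** The last clause serves rigidity, where both points of the pair must remain
    equal. *)
Theorem surjective_commutator_restrict L c c' : (forall i, a i <= L)%N ->
    suppN c -> suppN c' ->
    surjective_commutator predT c c' -> surjective_commutator predT c' c ->
  exists c1 c1', [/\ supp (lt p) c1 /\ supp (lt p) c1',
    surjective_commutator p c1 c1', surjective_commutator p c1' c1
    & c = c' -> c1 = c1'].
Proof.
move=> aL Nc Nc' s s'.
have [t [{}s {}s']] := surjective_commutator_deform s s'.
have Ntc : suppN (t *: c) by apply: supp_scale.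
have Ntc' : suppN (t *: c') by apply: supp_scale.
have [g [g' [c1 [gg' g'g [Ag Ag'] Nc1 [Dc1 eg]]]]] := block_diagonalize p aL Ntc.
(* for equal matrices the same conjugation is used twice *)
have [ecc'|ne] := eqVneq c c'.
  rewrite -{}ecc' in s s' Ntc'.
  have {}s := surjective_commutator_conj gg' g'g gg' g'g Ag Ag' Ag Ag' Ntc Ntc eg eg s.
  have {}s := surjective_commutator_corner Dc1 Dc1 s.
  by exists (D *m c1 *m D), (D *m c1 *m D); split=> //; split; apply: supp_corner.
have [h [h' [c1' [hh' h'h [Ah Ah'] Nc1' [Dc1' eh]]]]] :=
  block_diagonalize p aL Ntc'.
exists (D *m c1 *m D), (D *m c1' *m D); split.
- by split; apply: supp_corner.
- apply: surjective_commutator_corner => //.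
  exact: surjective_commutator_conj gg' g'g hh' h'h Ag Ag' Ah Ah' Ntc Ntc' eg eh s.
- apply: surjective_commutator_corner => //.
  exact: surjective_commutator_conj hh' h'h gg' g'g Ah Ah' Ag Ag' Ntc' Ntc eh eg s'.
- by move=> e; rewrite e eqxx in ne.
Qed.

End Deformation.

(** * Segment bases of representations *)

Section Frames.
Variables (k : fieldType) (n : nat) (p : pred 'I_n).
Implicit Types (a b : 'I_n -> nat) (d e : nat -> nat) (M : 'M[k]_n).

Definition seg_at a b (v : nat) : pred 'I_n := fun i => p i && (a i <= v <= b i)%N.

(** The rows of P v with index in seg_at v form a basis of V_v, the other rows
    are zero, and Q v gives the coordinates in this basis.  The last equation
    says that T maps each basis vector to the one of the same segment at the next
    vertex, or to zero at the end of the segment.  Keeping all the matrices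
    indexed by 'I_n at every vertex avoids transporting along equalities of
    dimensions. *)
Definition framed a b d (T : forall v, 'M[k]_(d v, d v.+1))
    (P : forall v, 'M[k]_(n, d v)) (Q : forall v, 'M[k]_(d v, n)) : Prop :=
  forall v, [/\ Q v *m P v = 1%:M, P v *m Q v = indicator_mx k (seg_at a b v)
              & T v = Q v *m P v.+1].

(** Maps lowering the grading by one are morphisms out of the shifted
    representation, so that a single statement about morphisms covers both h
    and B. *)
Lemma framed_shift a b d (T : forall v, 'M[k]_(d v, d v.+1)) P Q :
    (forall i, p i -> 0 < a i <= b i)%N -> framed a b T P Q ->
  @framed (fun i => (a i).-1) (fun i => (b i).-1) (fun v => d v.+1)
    (fun v => T v.+1) (fun v => P v.+1) (fun v => Q v.+1).
Proof.
move=> ab fr v; have [QP PQ TE] := fr v.+1; split=> //.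
rewrite PQ; apply/matrixP=> i j; rewrite !indicator_mxE /seg_at.
case pi: (p i); rewrite ?andbF //=; have abi := ab i pi.
by have -> : (a i <= v.+1 <= b i)%N = ((a i).-1 <= v <= (b i).-1)%N by lia.
Qed.

Lemma framed_conj a b d (T T' : forall v, 'M[k]_(d v, d v.+1)) P Q g :
    (forall v, g v \in unitmx) -> (forall v, T' v *m g v.+1 = g v *m T v) ->
    framed a b T P Q ->
  framed a b T' (fun v => P v *m invmx (g v)) (fun v => g v *m Q v).
Proof.
move=> gu gT fr v; have [QP PQ TE] := fr v; split.
- by rewrite mulmxA -(mulmxA (g v)) QP mulmx1 mulmxV.
- by rewrite mulmxA mulmxKV.
- by rewrite mulmxA -(mulmxA (g v)) -TE -gT mulmxK.
Qed.

Section Hom.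
Variables (a b a' b' : 'I_n -> nat) (d e : nat -> nat).
Variables (T : forall v, 'M[k]_(d v, d v.+1)) (T' : forall v, 'M[k]_(e v, e v.+1)).
Variables (P : forall v, 'M[k]_(n, d v)) (Q : forall v, 'M[k]_(d v, n)).
Variables (P' : forall v, 'M[k]_(n, e v)) (Q' : forall v, 'M[k]_(e v, n)).
Hypotheses (fr : framed a b T P Q) (fr' : framed a' b' T' P' Q').

(** Only the entries at pairs of segments alive at v and w are visible in the
    graded pieces. *)
Lemma framed_eq M M' v w : Q v *m M *m P' w = Q v *m M' *m P' w <->
  (forall i j, seg_at a b v i -> seg_at a' b' w j -> M i j = M' i j).
Proof.
have [QP PQ _] := fr v; have [QP' PQ' _] := fr' w; split=> [eM i j vi wj|eM].
  have : P v *m (Q v *m M *m P' w) *m Q' w = P v *m (Q v *m M' *m P' w) *m Q' w.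
    by rewrite eM.
  rewrite !mulmxA PQ -!mulmxA PQ' => /matrixP/(_ i j).
  by rewrite !indicator_mul !mul_indicator vi wj !mul1r !mulr1.
have QE : Q v = Q v *m indicator_mx k (seg_at a b v) by rewrite -PQ mulmxA QP mul1mx.
have PE : P' w = indicator_mx k (seg_at a' b' w) *m P' w.
  by rewrite -PQ' -mulmxA QP' mulmx1.
rewrite QE PE !mulmxA; congr (_ *m _); rewrite -!(mulmxA (Q v)); congr (_ *m _).
apply/matrixP=> i j; rewrite !mul_indicator !indicator_mul.
case vi: (seg_at a b v i); last by rewrite !mul0r.
by case wj: (seg_at a' b' w j); rewrite ?mulr0 ?eM.
Qed.

Definition seg_hom : rel 'I_n :=
  fun i j => [&& p i, p j, a' j <= a i & b' j <= b i]%N.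

Lemma framed_hom M v : supp seg_hom M ->
  T v *m (Q v.+1 *m M *m P' v.+1) = (Q v *m M *m P' v) *m T' v.
Proof.
move=> hM; have [QP PQ ->] := fr v; have [QP' PQ' ->] := fr' v.
have [_ PQ1 _] := fr v.+1.
rewrite !mulmxA -(mulmxA (Q v)) PQ1 -(mulmxA _ (P' v)) PQ'.
rewrite -(mulmxA (Q v) _ M) -(mulmxA (Q v) M); apply/framed_eq => i j.
rewrite indicator_mul mul_indicator => vi vj.
have [/and4P[pi pj aij bij]|/hM->] := boolP (seg_hom i j); last by rewrite mulr0 mul0r.
have -> : seg_at a b v.+1 i = seg_at a' b' v j.
  by move: vi vj; rewrite /seg_at pi pj /=; lia.
by rewrite mulrC.
Qed.

(** The matrix entry at (i, j) of a morphism is constant along the common part of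
    the two segments; it is zero if the target starts after the source does
    (look at the left end of the source), or ends after it (look at the right
    end of the source). *)
Lemma hom_framed (h : forall v, 'M[k]_(d v, e v)) :
    (forall i, p i -> a i <= b i)%N ->
    (forall v, T v *m h v.+1 = h v *m T' v) ->
  exists2 M, supp seg_hom M & forall v, h v = Q v *m M *m P' v.
Proof.
move=> ab hT; pose H v := P v *m h v *m Q' v.
have hH v : h v = Q v *m H v *m P' v.
  have [QP _ _] := fr v; have [QP' _ _] := fr' v.
  by rewrite /H !mulmxA QP mul1mx -mulmxA QP' mulmx1.
have Hsupp v i j : ~~ (seg_at a b v i && seg_at a' b' v j) -> H v i j = 0.
  move=> nv; have [QP PQ _] := fr v; have [QP' PQ' _] := fr' v.
  have -> : H v = indicator_mx k (seg_at a b v) *m H v *m indicator_mx k (seg_at a' b' v).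
    by rewrite -PQ -PQ' [LHS]/H hH !mulmxA.
  rewrite mul_indicator indicator_mul; move: nv; rewrite negb_and.
  by case/orP=> /negPf->; rewrite ?mul0r ?mulr0.
have Hstep v i j : seg_at a b v i -> seg_at a' b' v.+1 j -> H v.+1 i j = H v i j.
  move=> vi vj; have [QP PQ TE] := fr v; have [QP' PQ' TE'] := fr' v.
  have [_ PQ1 _] := fr' v.+1.
  have : P v *m (T v *m h v.+1) *m Q' v.+1 = P v *m (h v *m T' v) *m Q' v.+1.
    by rewrite hT.
  rewrite TE TE' -!mulmxA PQ1 (mulmxA (P v) (Q v)) PQ => /matrixP/(_ i j).
  rewrite indicator_mul vi mul1r !mulmxA => ->.
  by rewrite mul_indicator vj mulr1.
have HE i j m : p i -> (a i + m <= b i)%N ->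
    H (a i + m)%N i j = (seg_at a' b' (a i + m) j)%:R * H (a i) i j.
  move=> pi; elim: m => [_|m IH lem].
    rewrite addn0; case vj: (seg_at a' b' (a i) j); first by rewrite mul1r.
    by rewrite mul0r Hsupp // vj andbF.
  have vi : seg_at a b (a i + m) i by rewrite /seg_at pi; lia.
  rewrite addnS; case vj: (seg_at a' b' (a i + m).+1 j); last first.
    by rewrite mul0r Hsupp // vj andbF.
  rewrite Hstep // IH; last lia.
  case wj: (seg_at a' b' (a i + m) j) => //.
  rewrite [in RHS]Hsupp ?mulr0 ?mul0r //; move: vj wj; rewrite /seg_at; lia.
(* each entry is read off at the left end of the source *)
exists (\matrix_(i, j) if p i then H (a i) i j else 0).
  move=> i j; rewrite mxE; case pi: (p i) => // nij.
  have abi := ab i pi.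
  have [aj|/negPf naj] := boolP (seg_at a b (a i) i && seg_at a' b' (a i) j); last first.
    by rewrite Hsupp ?naj.
  have [vi vj] := andP aj; have pj : p j by case/andP: vj.
  have lt_b : (b i < b' j)%N by move: nij vj; rewrite /seg_hom /seg_at pi pj /=; lia.
  have <- : H (b i).+1 i j = H (a i) i j.
    rewrite Hstep; [|by rewrite /seg_at pi; lia|by move: vj; rewrite /seg_at; lia].
    rewrite -[b i](subnKC abi) HE //; last lia.
    rewrite subnKC //; have -> : seg_at a' b' (b i) j.
      by move: vj; rewrite /seg_at; lia.
    by rewrite mul1r.
  by rewrite Hsupp // /seg_at ltnn !andbF.
move=> v; rewrite [LHS]hH; apply/framed_eq => i j vi vj.
have /andP[pi /andP[av vb]] := vi.
by rewrite [in RHS]mxE pi -(subnKC av) HE ?subnKC ?vj ?mul1r.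
Qed.
End Hom.
End Frames.

(** * Commutator maps in segment bases *)

(** Surjectivity of h |-> h B' - B h onto the space of maps that lower the grading
    by one and commute with T, which is dual to Ext^1 of T-representations. *)
Definition bracket_surjective (k : fieldType) N (d e : dimvec N)
    (x : Lambda k d) (y : Lambda k e) : Prop :=
  forall beta : forall v, 'M[k]_(d v.+1, e v),
    (forall v, beta v *m lamT y v = lamT x v.+1 *m beta v.+1) ->
  exists2 h : forall v, 'M[k]_(d v, e v),
    forall v, lamT x v *m h v.+1 = h v *m lamT y v &
    forall v, beta v = h v.+1 *m lamB y v - lamB x v *m h v.

Section FramedBracket.
Variables (k : closedFieldType) (n N : nat) (p : pred 'I_n) (a b : 'I_n -> nat).
Hypothesis ab : forall i, p i -> (0 < a i <= b i)%N.

Lemma seg_hom_shift :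
  seg_hom p (fun i => (a i).-1) (fun i => (b i).-1) a b =2 seg_lt a b p.
Proof.
move=> i j; rewrite /seg_hom /seg_lt; case pi: (p i) => //=.
by have := ab pi; case: (p j) => //= abi; lia.
Qed.

Section Pair.
Variables (d e : nat -> nat).
Variables (T : forall v, 'M[k]_(d v, d v.+1)) (T' : forall v, 'M[k]_(e v, e v.+1)).
Variables (P : forall v, 'M[k]_(n, d v)) (Q : forall v, 'M[k]_(d v, n)).
Variables (P' : forall v, 'M[k]_(n, e v)) (Q' : forall v, 'M[k]_(e v, n)).
Hypotheses (fr : framed p a b T P Q) (fr' : framed p a b T' P' Q').

Lemma backward_framed (beta : forall v, 'M[k]_(d v.+1, e v)) :
    (forall v, beta v *m T' v = T v.+1 *m beta v.+1) ->
  exists2 M, supp (seg_lt a b p) M & forall v, beta v = Q v.+1 *m M *m P' v.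
Proof.
move=> hb; have [|v|M hM bE] := @hom_framed _ _ p _ _ _ _ _ _ _ _ _ _ _ _
    (framed_shift ab fr) fr' beta.
- by move=> i /ab; lia.
- by rewrite hb.
by exists M => //; apply: suppS hM => i j; rewrite seg_hom_shift.
Qed.

Lemma framed_backward M v : supp (seg_lt a b p) M ->
  (Q v.+1 *m M *m P' v) *m T' v = T v.+1 *m (Q v.+2 *m M *m P' v.+1).
Proof.
move=> hM; symmetry; apply: (framed_hom (framed_shift ab fr) fr').
by apply: suppS hM => i j; rewrite seg_hom_shift.
Qed.

End Pair.

(** Composing through the graded piece at a vertex inserts a projection between
    two matrices; it can be dropped if the segments it kills do not contribute. *)
Lemma mul_indicator_through (q : pred 'I_n) (M M' : 'M[k]_n) i j :
    (forall l, ~~ q l -> M i l * M' l j = 0) ->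
  (M *m indicator_mx k q *m M') i j = (M *m M') i j.
Proof.
move=> h; rewrite !mxE; apply: eq_bigr => l _; rewrite mul_indicator.
by case: (boolP (q l)) => [_|/h]; rewrite ?mulr1 // mulr0 mul0r.
Qed.

Lemma framed_bracket (d e : dimvec N) (x : Lambda k d) (y : Lambda k e)
    P Q P' Q' c c' :
    framed p a b (lamT x) P Q -> framed p a b (lamT y) P' Q' ->
    supp (seg_lt a b p) c -> (forall v, lamB x v = Q v.+1 *m c *m P v) ->
    supp (seg_lt a b p) c' -> (forall v, lamB y v = Q' v.+1 *m c' *m P' v) ->
  bracket_surjective x y <-> surjective_commutator a b p c c'.
Proof.
move=> fr fr' hc xB hc' yB.
have bracketE eta v : supp (seg_le a b p) eta ->
    (Q v.+1 *m eta *m P' v.+1) *m lamB y v - lamB x v *m (Q v *m eta *m P' v) =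
    Q v.+1 *m (eta *m c' - c *m eta) *m P' v.
  move=> heta; rewrite mulmxBr mulmxBl; congr (_ - _).
    have [_ PQ _] := fr' v.+1.
    have -> : Q v.+1 *m eta *m P' v.+1 *m lamB y v =
        Q v.+1 *m (eta *m indicator_mx k (seg_at p a b v.+1) *m c') *m P' v.
      by rewrite yB -PQ !mulmxA.
    apply/(framed_eq fr fr') => i j iv jv; apply: mul_indicator_through => l nl.
    have [/and4P[pi pl ? ?]|/heta->] := boolP (seg_le a b p i l); last by rewrite mul0r.
    have [/and4P[_ pj ? ?]|/hc'->] := boolP (seg_lt a b p l j); last by rewrite mulr0.
    by case/negP: nl; move: iv jv; rewrite /seg_at pi pl pj /=; lia.
  have [_ PQ _] := fr v.
  have -> : lamB x v *m (Q v *m eta *m P' v) =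
      Q v.+1 *m (c *m indicator_mx k (seg_at p a b v) *m eta) *m P' v.
    by rewrite xB -PQ !mulmxA.
  apply/(framed_eq fr fr') => i j iv jv; apply: mul_indicator_through => l nl.
  have [/and4P[pi pl ? ?]|/hc->] := boolP (seg_lt a b p i l); last by rewrite mul0r.
  have [/and4P[_ pj ? ?]|/heta->] := boolP (seg_le a b p l j); last by rewrite mulr0.
  by case/negP: nl; move: iv jv; rewrite /seg_at pi pl pj /=; lia.
split=> [bs xi hxi|sc beta hbeta].
  have [h hT hB] := bs _ (fun v => framed_backward fr fr' v hxi).
  have [|eta heta hE] := hom_framed fr fr' _ hT; first by move=> i /ab /andP[].
  exists eta => // i j /and4P[pi pj aij bij] tij.
  (* at the right end of j both segments are alive, one step apart *)
  have : Q (b j).+1 *m (eta *m c' - c *m eta) *m P' (b j) = Q (b j).+1 *m xi *m P' (b j).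
    by rewrite -bracketE // -!hE -hB.
  by move/(framed_eq fr fr'); apply; rewrite /seg_at ?pi ?pj /=; have := ab pj; lia.
have [xi hxi bE] := backward_framed fr fr' hbeta.
have [eta heta eE] := sc xi hxi.
exists (fun v => Q v *m eta *m P' v) => v; first exact: (framed_hom fr fr').
rewrite bracketE // bE; apply/(framed_eq fr fr') => i j iv jv.
(* outside seg_lt both sides vanish, as N is an ideal *)
have [lij|nij] := boolP (seg_lt a b p i j).
  by rewrite eE //; move: iv jv; rewrite /seg_at; lia.
rewrite hxi //; suff -> : (eta *m c' - c *m eta) i j = 0 by [].
have sN : supp (seg_lt a b p) (eta *m c' - c *m eta).
  apply: supp_sub.
    by apply: supp_mul heta hc' => i' l j'; apply: seg_le_lt_trans.
  by apply: supp_mul hc heta => i' l j'; apply: seg_lt_le_trans.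
exact: sN.
Qed.

End FramedBracket.

(** * Segment bases of direct sums of segment representations *)

Lemma ord_bool_irrelevance (B : bool) (u w : 'I_B) : u = w.
Proof. by apply/val_inj; case: B u w => -[u ltu] [w ltw] /=; lia. Qed.

Section MultisegmentFrame.
Variables (k : fieldType) (N n : nat) (m : 'I_n -> segment N).
Let a i : nat := sbeg (m i).
Let b i : nat := send (m i).

Definition has_frame (p : pred 'I_n) (M : rep k N) :=
  exists P Q, framed p a b (rep_map M) P Q.

Lemma has_frame0 : has_frame pred0 (rep0 k N).
Proof.
exists (fun=> 0), (fun=> 0) => v; split.
- by apply/matrixP; case.
- by apply/matrixP=> i j; rewrite mulmx0 indicator_mxE andbF mxE.
- by apply/matrixP; case.
Qed.

Lemma has_frame_seg i : has_frame (pred1 i) (seg_rep k (m i)).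
Proof.
exists (fun v => \matrix_(j, _) (j == i)%:R), (fun v => \matrix_(_, j) (j == i)%:R) => v.
have sum1 : \sum_j ((j == i)%:R * (j == i)%:R : k) = 1.
  by rewrite (bigD1 i) //= big1 ?addr0 ?eqxx ?mulr1 // => j /negPf->; rewrite mulr0.
split.
- apply/matrixP=> u w; rewrite !mxE; under eq_bigr do rewrite !mxE.
  by rewrite sum1 (ord_bool_irrelevance u w) eqxx.
- apply/matrixP=> j l; rewrite indicator_mxE !mxE; under eq_bigr do rewrite !mxE.
  rewrite sumr_const card_ord /seg_at /seg_mem /= -/(a i) -/(b i).
  have [->|ne] := eqVneq j l; last first.
    have [ej|] := eqVneq j i; last by rewrite mul0r mul0rn.
    by rewrite -ej eq_sym (negPf ne) mulr0 mul0rn.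
  have [->|_] := eqVneq l i; last by rewrite mul0r mul0rn.
  by rewrite mulr1.
- apply/matrixP=> u w; rewrite !mxE; under eq_bigr do rewrite !mxE.
  by rewrite sum1.
Qed.

Lemma has_frame_dsum (p1 p2 : pred 'I_n) M1 M2 : (forall i, p1 i -> ~~ p2 i) ->
  has_frame p1 M1 -> has_frame p2 M2 -> has_frame (predU p1 p2) (rep_dsum M1 M2).
Proof.
move=> disj [P1 [Q1 f1]] [P2 [Q2 f2]].
have QP12 v w : Q1 v *m P2 w = 0.
  have [E1 S1 _] := f1 v; have [E2 S2 _] := f2 w.
  have -> : Q1 v *m P2 w = Q1 v *m (P1 v *m Q1 v *m (P2 w *m Q2 w)) *m P2 w.
    by rewrite !mulmxA E1 mul1mx -2!mulmxA E2 mulmx1.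
  suff -> : P1 v *m Q1 v *m (P2 w *m Q2 w) = 0 by rewrite mulmx0 mul0mx.
  apply/matrixP=> i j; rewrite S1 S2 indicator_mul indicator_mxE mxE /seg_at.
  case: (boolP (p1 i)) => [/disj/negPf p2i|_]; last by rewrite mul0r.
  by rewrite p2i andbF mulr0.
have QP21 v w : Q2 v *m P1 w = 0.
  have [E1 S1 _] := f1 w; have [E2 S2 _] := f2 v.
  have -> : Q2 v *m P1 w = Q2 v *m (P2 v *m Q2 v *m (P1 w *m Q1 w)) *m P1 w.
    by rewrite !mulmxA E2 mul1mx -2!mulmxA E1 mulmx1.
  suff -> : P2 v *m Q2 v *m (P1 w *m Q1 w) = 0 by rewrite mulmx0 mul0mx.
  apply/matrixP=> i j; rewrite S1 S2 indicator_mul indicator_mxE mxE /seg_at.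
  case: (boolP (p1 i)) => [/disj/negPf p2i|_]; last by rewrite andbF mulr0.
  by rewrite p2i mul0r.
exists (fun v => row_mx (P1 v) (P2 v)), (fun v => col_mx (Q1 v) (Q2 v)) => v.
have [E1 S1 T1] := f1 v; have [E2 S2 T2] := f2 v; split.
- by rewrite mul_col_row E1 E2 QP12 QP21 -scalar_mx_block.
- rewrite mul_row_col S1 S2; apply/matrixP=> i j; rewrite mxE !indicator_mxE /seg_at /=.
  case: (boolP (p1 i)) => [/disj/negPf ->|_] /=; first by rewrite andbF addr0.
  by rewrite andbF add0r.
- by rewrite mul_col_row QP12 QP21 /= T1 T2.
Qed.

Lemma eq_has_frame (p q : pred 'I_n) M : p =1 q -> has_frame p M -> has_frame q M.
Proof.
move=> pq [P [Q f]]; exists P, Q => v; have [E S T] := f v; split=> //.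
by rewrite S; apply/matrixP=> i j; rewrite !indicator_mxE /seg_at pq.
Qed.

Lemma has_frame_big r : uniq r ->
  has_frame [pred i | i \in r] (\big[@rep_dsum k N/rep0 k N]_(i <- r) seg_rep k (m i)).
Proof.
elim: r => [_|i r IH /= /andP[nir ur]].
  by rewrite big_nil; apply: eq_has_frame has_frame0.
rewrite big_cons; apply: eq_has_frame (has_frame_dsum _ (has_frame_seg i) (IH ur)) => [j|j /eqP->//].
by rewrite /= inE.
Qed.

Lemma has_frame_multiseg (L : finType) (mL : multisegment N L) (phi : L -> 'I_n)
    (q : pred 'I_n) :
    injective phi -> (forall l, mL l = m (phi l)) -> q =1 [pred i | i \in codom phi] ->
  has_frame q (multiseg_rep k mL).
Proof.
move=> phi_inj mE qE.
have -> : multiseg_rep k mL =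
    \big[@rep_dsum k N/rep0 k N]_(i <- map phi (index_enum L)) seg_rep k (m i).
  by rewrite big_map; apply: eq_bigr => i _; rewrite mE.
apply: eq_has_frame (has_frame_big _) => [i|]; last first.
  by rewrite map_inj_uniq ?index_enum_uniq.
rewrite qE /=; apply/mapP/codomP => [[l _ ->]|[l ->]]; first by exists l.
by exists l; rewrite ?mem_index_enum.
Qed.

End MultisegmentFrame.

(** * Finite-dimensional linear algebra of graded families *)

Lemma eq_mx_rows0 (R : Type) r s (M M' : 'M[R]_(r, s)) : r = 0%N -> M = M'.
Proof. by move=> r0; subst r; apply/matrixP=> -[]. Qed.

Section Families.
Variables (k : fieldType) (n : nat) (p q : nat -> nat).
Implicit Types f g : forall v : nat, 'M[k]_(p v, q v).

Definition fam_index : finType := {v : 'I_n & ('I_(p v) * 'I_(q v))%type}.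

Definition fam_vec f : 'rV[k]_#|fam_index| :=
  \row_(t < #|fam_index|)
    let s : fam_index := enum_val t in f (tag s) (tagged s).1 (tagged s).2.

(** A row vector only determines the members of the family below n; zero is the
    default value beyond, where the matrices of interest have no entries. *)
Definition vec_fam (u : 'rV[k]_#|fam_index|) (v : nat) : 'M[k]_(p v, q v) :=
  match @idP (v < n)%N with
  | ReflectT lt_v => \matrix_(i, j)
      u 0 (enum_rank (existT _ (Ordinal lt_v) (i, j) : fam_index))
  | ReflectF _ => 0
  end.

Lemma eq_fam_vec f g : (forall v, f v = g v) -> fam_vec f = fam_vec g.
Proof. by move=> fg; apply/rowP=> t; rewrite !mxE /= fg. Qed.

Lemma vec_famK u : fam_vec (vec_fam u) = u.
Proof.
apply/rowP=> t; rewrite mxE -[in RHS](enum_valK t).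
case: (enum_val t) => [[v lt_v] [i j]] /=; rewrite /vec_fam.
by case: {-}_ / idP => // lt_v'; rewrite mxE (bool_irrelevance lt_v' lt_v).
Qed.

Lemma fam_vecK f : (forall v, n <= v -> p v = 0)%N ->
  forall v, vec_fam (fam_vec f) v = f v.
Proof.
move=> p0 v; rewrite /vec_fam; case: {-}_ / idP => [lt_v|/negP].
  by apply/matrixP=> i j; rewrite !mxE enum_rankK.
rewrite -leqNgt => /p0; exact: eq_mx_rows0.
Qed.

Lemma vec_fam_linear t u u' v : vec_fam (t *: u + u') v = t *: vec_fam u v + vec_fam u' v.
Proof.
rewrite /vec_fam; case: {-}_ / idP => [lt_v|_]; last by rewrite scaler0 addr0.
by apply/matrixP=> i j; rewrite !mxE.
Qed.

Lemma fam_vec_linear t f g :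
  fam_vec (fun v => t *: f v + g v) = t *: fam_vec f + fam_vec g.
Proof. by apply/rowP=> s; rewrite !mxE /= !mxE. Qed.

Lemma fam_vec_eq0 f : (forall v, f v = 0) -> fam_vec f = 0.
Proof. by move=> f0; apply/rowP=> s; rewrite !mxE /= f0 mxE. Qed.

End Families.

Lemma fam_vec_pairing (k : fieldType) n (p q : nat -> nat)
    (f : forall v, 'M[k]_(p v, q v)) (g : forall v, 'M[k]_(q v, p v)) :
  (fam_vec n f *m (fam_vec n (fun v => (g v)^T))^T) 0 0 =
  \sum_(v < n) \tr (f v *m g v).
Proof.
pose F (s : fam_index n p q) :=
  f (tag s) (tagged s).1 (tagged s).2 * g (tag s) (tagged s).2 (tagged s).1.
rewrite mxE (eq_bigr (fun t => F (enum_val t))) => [|t _]; last by rewrite !mxE /= !mxE.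
rewrite -(big_enum_val F) (eq_bigl xpredT) //.
pose J (v : 'I_n) : finType := ('I_(p v) * 'I_(q v))%type.
rewrite -(@sig_big_dep _ _ _ _ J xpredT (fun _ => xpredT) (fun v s => F (existT _ v s))) /=.
apply: eq_bigr => v _; rewrite -(pair_bigA _ (fun i j => f v i j * g v j i)) /=.
by apply: eq_bigr => i _; rewrite mxE.
Qed.

Lemma submx_annihilator (k : fieldType) q r (u : 'rV[k]_r) (D : 'M[k]_(q, r)) :
  (forall w : 'cV_r, D *m w = 0 -> u *m w = 0) -> (u <= D)%MS.
Proof.
move=> h; rewrite submxE; apply/eqP/matrixP=> i j.
have : u *m (cokermx D *m delta_mx j (0 : 'I_1)) = 0.
  by apply: h; rewrite mulmxA mulmx_coker mul0mx.
by rewrite mulmxA -colE => /matrixP/(_ i 0); rewrite mxE [RHS]mxE => ->; rewrite mxE.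
Qed.

Lemma mul_rV_lin1_fun (k : fieldType) q r (f : 'rV[k]_q -> 'rV[k]_r) u :
  linear f -> u *m lin1_mx f = f u.
Proof.
move=> lf; pose F : {linear _ -> _} :=
  HB.pack f (GRing.isLinear.Build _ _ _ _ _ lf).
exact: (mul_rV_lin1 F u).
Qed.

(** An exact complex of vector spaces has a contracting homotopy. *)
Lemma exact_homotopy (k : fieldType) q r s (D1 : 'M[k]_(q, r)) (D2 : 'M[k]_(r, s)) :
  (kermx D2 <= D1)%MS -> exists S1 S2, S1 *m D1 + D2 *m S2 = 1%:M.
Proof.
move=> ex; have /submxP[S1 e1] : (1%:M - D2 *m pinvmx D2 <= D1)%MS.
  by apply: submx_trans ex; rewrite sub_kermx mulmxBl mul1mx mulmxKpV ?subrr.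
by exists S1, (pinvmx D2); rewrite -e1 subrK.
Qed.

(** A homotopy that contracts one complex contracts all nearby ones up to an
    invertible map; that suffices for exactness, since the map sends the kernel
    injectively into the image, which is contained in the kernel.  This makes
    exactness visibly an open condition. *)
Lemma homotopy_exact (k : fieldType) q r s (D1 : 'M[k]_(q, r)) (D2 : 'M[k]_(r, s)) S1 S2 :
  D1 *m D2 = 0 -> S1 *m D1 + D2 *m S2 \in unitmx -> (kermx D2 <= D1)%MS.
Proof.
move=> D1D2 u; set H := _ + _ in u.
have KH : kermx D2 *m H = kermx D2 *m S1 *m D1.
  by rewrite /H mulmxDr !mulmxA mulmx_ker mul0mx addr0.
have : (kermx D2 *m H <= kermx D2)%MS by rewrite sub_kermx KH -mulmxA D1D2 mulmx0.
move/mxrank_leqif_eq; rewrite mxrankMfree ?row_free_unit // => -[_].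
rewrite eqxx => /esym/eqmxP e; rewrite -e KH; exact: submxMl.
Qed.

(** * The complex computing first extensions *)

Lemma dimv_gt N (d : dimvec N) v : (N < v)%N -> d v = 0%N.
Proof. by move=> ltNv; apply: dimv_supp; rewrite negb_and -!ltnNge ltNv orbT. Qed.

Section Cochains.
Variables (k : fieldType) (N : nat) (d e : dimvec N).
Variables (T : RQ k d) (B : RQop k d) (T' : RQ k e) (B' : RQop k e).
Let n := N.+1.

Definition cochain0 := forall v, 'M[k]_(d v, e v).
Definition cochainT := forall v, 'M[k]_(d v, e v.+1).
Definition cochainB := forall v, 'M[k]_(d v.+1, e v).

Definition cobT (h : cochain0) : cochainT := fun v => T v *m h v.+1 - h v *m T' v.
Definition cobB (h : cochain0) : cochainB := fun v => B v *m h v - h v.+1 *m B' v.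

(** The cocycles are the off-diagonal blocks (al, be) for which the block
    triangular extension of (T, B) by (T', B') satisfies the relations of the
    preprojective algebra; the coboundaries are those of the extensions split by
    a section (1, h). *)
Definition cocycle_defect (al : cochainT) (be : cochainB) v : 'M[k]_(d v.+1, e v.+1) :=
  B v *m al v + be v *m T' v - (T v.+1 *m be v.+1 + al v.+1 *m B' v.+1).

Definition cocycle al be := forall v, cocycle_defect al be v = 0.
Definition coboundary al be :=
  exists h, (forall v, al v = cobT h v) /\ (forall v, be v = cobB h v).

Definition cochain_vec (al : cochainT) (be : cochainB) := row_mx (fam_vec n al) (fam_vec n be).

Definition cob_vec (u : 'rV[k]_#|fam_index n d e|) :=
  cochain_vec (cobT (vec_fam u)) (cobB (vec_fam u)).
Definition cob_mx := lin1_mx cob_vec.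

Definition defect_vec u := fam_vec n (cocycle_defect
  (vec_fam (lsubmx u : 'rV_#|fam_index n d (fun v => e v.+1)|))
  (vec_fam (rsubmx u : 'rV_#|fam_index n (fun v => d v.+1) e|))).
Definition defect_mx := lin1_mx defect_vec.

Lemma cob_vec_linear : linear cob_vec.
Proof.
move=> t u u'; rewrite /cob_vec /cochain_vec scale_row_mx add_row_mx -!fam_vec_linear.
congr row_mx; apply: eq_fam_vec => v; rewrite /cobT /cobB !vec_fam_linear.
  rewrite mulmxDr mulmxDl -scalemxAr -scalemxAl scalerBr opprD.
  by rewrite addrACA.
rewrite mulmxDr mulmxDl -scalemxAr -scalemxAl scalerBr opprD.
by rewrite addrACA.
Qed.

Lemma defect_vec_linear : linear defect_vec.
Proof.
move=> t u u'; rewrite /defect_vec -fam_vec_linear; apply: eq_fam_vec => v.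
rewrite /cocycle_defect !linearP /= !vec_fam_linear !mulmxDr !mulmxDl -!scalemxAr -!scalemxAl.
move: (B v *m _) (B v *m _) (_ *m T' v) (_ *m T' v) (T v.+1 *m _) (T v.+1 *m _).
move: (_ *m B' v.+1) (_ *m B' v.+1) => *.
by apply/matrixP=> i j; rewrite !mxE; ring.
Qed.

Lemma vec_fam_cochain0 (h : cochain0) v : vec_fam (fam_vec n h) v = h v.
Proof. by apply: fam_vecK => w; apply: dimv_gt. Qed.
Lemma vec_fam_cochainT (al : cochainT) v : vec_fam (fam_vec n al) v = al v.
Proof. by apply: fam_vecK => w; apply: dimv_gt. Qed.
Lemma vec_fam_cochainB (be : cochainB) v : vec_fam (fam_vec n be) v = be v.
Proof. by apply: fam_vecK => w ltNw; apply: dimv_gt; apply: leqW. Qed.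

Lemma coboundaryP al be : coboundary al be <-> (cochain_vec al be <= cob_mx)%MS.
Proof.
split=> [[h [hT hB]]|/submxP[u]].
  have -> : cochain_vec al be = cob_vec (fam_vec n h).
    congr row_mx; apply: eq_fam_vec => v; rewrite ?hT ?hB /cobT /cobB !vec_fam_cochain0 //.
  by rewrite -mul_rV_lin1_fun ?submxMl //; apply: cob_vec_linear.
rewrite mul_rV_lin1_fun; last exact: cob_vec_linear.
move=> /eq_row_mx[eT eB]; exists (vec_fam u); split=> v.
  by rewrite -vec_fam_cochainT eT vec_fam_cochainT.
by rewrite -vec_fam_cochainB eB vec_fam_cochainB.
Qed.

Lemma cocycle_coboundaryP : (forall al be, cocycle al be -> coboundary al be) <->
  (kermx defect_mx <= cob_mx)%MS.
Proof.
split=> [ex|ex al be co].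
  apply/row_subP=> i; set u := row i _.
  have u0 : u *m defect_mx = 0 by rewrite -row_mul mulmx_ker row0.
  have -> : u = cochain_vec (vec_fam (lsubmx u)) (vec_fam (rsubmx u)).
    by rewrite /cochain_vec !vec_famK hsubmxK.
  apply/coboundaryP/ex => v; move: u0.
  rewrite mul_rV_lin1_fun; last exact: defect_vec_linear.
  move=> u0; rewrite -[LHS](@fam_vecK _ n _ _ (cocycle_defect _ _)); last first.
    by move=> w ltNw; apply: dimv_gt; apply: leqW.
  have -> : fam_vec n (cocycle_defect (vec_fam (lsubmx u)) (vec_fam (rsubmx u))) = 0 := u0.
  rewrite /vec_fam; case: {-}_ / idP => // ltv.
  by apply/matrixP=> s t; rewrite !mxE.
apply/coboundaryP; apply: submx_trans ex; rewrite sub_kermx.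
rewrite mul_rV_lin1_fun; last exact: defect_vec_linear.
apply/eqP/fam_vec_eq0 => v; rewrite -[RHS](co v) /cocycle_defect row_mxKl row_mxKr.
by rewrite !vec_fam_cochainT !vec_fam_cochainB.
Qed.

End Cochains.

(** * Trace duality, and extensions as cocycles *)

Section Duality.
Variables (k : fieldType) (N : nat) (d e : dimvec N).
Variables (T : RQ k d) (B : RQop k d) (T' : RQ k e) (B' : RQop k e).
Let n := N.+1.

(** The sign makes the cocycle condition for (y, x) the adjoint of the coboundary
    map for (x, y), so that the complex is its own dual. *)
Definition cochain_pairing (al : cochainT k d e) (be : cochainB k d e)
    (al' : cochainT k e d) (be' : cochainB k e d) : k :=
  \sum_(v < n) (\tr (al v *m be' v) - \tr (be v *m al' v)).

(** Matrix units among the families; indices are compared as natural numbers since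
    w and v are only propositionally equal. *)
Definition elementary (v : nat) (s : 'I_(d v)) (t : 'I_(e v)) : cochain0 k d e :=
  fun w => \matrix_(i, j) [&& w == v, i == s :> nat & j == t :> nat]%:R.

Lemma elementary_at v s t : @elementary v s t v = delta_mx s t.
Proof. by apply/matrixP=> i j; rewrite !mxE eqxx. Qed.

Lemma elementary_off v s t w : w != v -> @elementary v s t w = 0.
Proof. by move=> /negPf wv; apply/matrixP=> i j; rewrite !mxE wv. Qed.

Lemma trace_delta r c (s : 'I_r) (t : 'I_c) (M : 'M[k]_(c, r)) :
  \tr (delta_mx s t *m M) = M t s.
Proof.
rewrite /mxtrace (bigD1 s) //= big1 ?addr0 => [|i /negPf ne]; rewrite mxE.
  rewrite (bigD1 t) //= big1 ?addr0 => [|j /negPf ne]; rewrite mxE eqxx ?ne ?mul0r //.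
  by rewrite eqxx mul1r.
by rewrite big1 // => j _; rewrite mxE ne mul0r.
Qed.

(** A subspace is the annihilator of its annihilator.  Stated for
    maps B and B' rather than for points of Lambda, it gives the duality for
    representations of the quiver alone when B = B' = 0. *)
Lemma coboundary_dual al be :
    (forall al' be', cocycle T' B' T B al' be' -> cochain_pairing al be al' be' = 0) ->
  coboundary T B T' B' al be.
Proof.
move=> orth; apply/coboundaryP/submx_annihilator => w w0.
pose be' v : 'M[k]_(e v.+1, d v) :=
  (vec_fam ((usubmx w)^T : 'rV_#|fam_index n d (fun v => e v.+1)|) v)^T.
pose al' v : 'M[k]_(e v, d v.+1) :=
  - (vec_fam ((dsubmx w)^T : 'rV_#|fam_index n (fun v => d v.+1) e|) v)^T.
have mul_w al0 be0 : (cochain_vec al0 be0 *m w) 0 0 = cochain_pairing al0 be0 al' be'.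
  rewrite -[w]vsubmxK mul_row_col mxE -[usubmx w]trmxK -[dsubmx w]trmxK.
  rewrite -[(usubmx w)^T]vec_famK -[(dsubmx w)^T]vec_famK /cochain_pairing sumrB.
  congr (_ + _).
    rewrite -(fam_vec_pairing n al0 be'); congr ((_ *m _^T) 0 0).
    by apply: eq_fam_vec => v; rewrite trmxK.
  rewrite -sumrN; under eq_bigr do rewrite /al' mulmxN linearN /= opprK.
  rewrite -(fam_vec_pairing n be0 (fun v => (vec_fam _ v)^T)).
  by congr ((_ *m _^T) 0 0); apply: eq_fam_vec => v; rewrite trmxK.
apply/rowP=> i; rewrite (ord1 i) mul_w [RHS]mxE; apply: orth => v.
have [leNv|ltvN] := leqP N v.
  by apply: trmx_inj; apply: eq_mx_rows0; apply: dimv_gt.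
apply/matrixP=> t s; rewrite [RHS]mxE.
(* the coefficients of h in the pairing with the coboundary of h *)
pose h := elementary s t; pose X w := be' w *m T w + B' w *m al' w.
pose Y w := T' w *m be' w + al' w *m B w.
have : \sum_(w < n) (\tr (h w.+1 *m X w) - \tr (h w *m Y w)) = 0.
  transitivity (cochain_pairing (cobT T T' h) (cobB B B' h) al' be'); last first.
    rewrite -mul_w; have /coboundaryP/submxP[D ->] :
        coboundary T B T' B' (cobT T T' h) (cobB B B' h) by exists h.
    by rewrite -mulmxA w0 mulmx0 mxE.
  apply: eq_bigr => u _; rewrite /cobT /cobB /X /Y !mulmxBl !mulmxDr !linearB !linearD /=.
  rewrite !mulmxA [\tr (h u.+1 *m be' u *m _)]mxtrace_mulC [\tr (h u *m al' u *m _)]mxtrace_mulC !mulmxA.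
  ring.
rewrite /h sumrB (bigD1 (Ordinal (leqW ltvN))) //= elementary_at trace_delta.
rewrite big1 ?addr0 => [|u /negPf ne]; last first.
  rewrite elementary_off ?mul0mx ?linear0 // eqSS; exact: negbT ne.
rewrite (bigD1 (Ordinal (ltvN : v.+1 < n)%N)) //= elementary_at trace_delta.
rewrite big1 ?addr0 => [|u ne]; last by rewrite elementary_off ?mul0mx ?linear0.
move=> /eqP; rewrite subr_eq0 => /eqP XY.
have -> : cocycle_defect T' B' T B al' be' v = X v - Y v.+1.
  by rewrite /cocycle_defect [B' v *m _ + _]addrC.
by rewrite mxE [in X in _ + X]mxE XY subrr.
Qed.

End Duality.

Section ExtensionGroup.
Variables (k : fieldType) (N : nat).

Lemma coboundary_cocycle (d e : dimvec N) (x : Lambda k d) (y : Lambda k e) al be :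
  coboundary (lamT x) (lamB x) (lamT y) (lamB y) al be ->
  cocycle (lamT x) (lamB x) (lamT y) (lamB y) al be.
Proof.
case=> h [alE beE] v; rewrite /cocycle_defect !alE !beE /cobT /cobB.
rewrite !mulmxBr !mulmxBl !mulmxA !lam_rel -!mulmxA lam_rel.
move: (lamT x v.+1 *m _) (lamT x v.+1 *m _) (lamB x v *m _) (h v.+1 *m _) => *.

by apply/matrixP=> i j; rewrite !mxE; ring.
Qed.

Lemma cob_defect_mx (d e : dimvec N) (x : Lambda k d) (y : Lambda k e) :
  cob_mx (lamT x) (lamB x) (lamT y) (lamB y) *m
  defect_mx (lamT x) (lamB x) (lamT y) (lamB y) = 0.
Proof.
apply/row_matrixP=> i; rewrite row_mul row0 rowE.
rewrite (mul_rV_lin1_fun _ (cob_vec_linear _ _ _ _)).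
rewrite (mul_rV_lin1_fun _ (defect_vec_linear _ _ _ _)).
apply: fam_vec_eq0 => v; rewrite /cob_vec /cochain_vec row_mxKl row_mxKr.
rewrite /cocycle_defect !vec_fam_cochainT !vec_fam_cochainB.
by apply: coboundary_cocycle; exists (vec_fam (delta_mx 0 i)).
Qed.

(** Every extension splits as graded spaces, so it is isomorphic to a block
    triangular one; in the forward direction the block triangular extension
    defined by a cocycle is tested, in the backward direction a graded section
    s0 measures the failure of an arbitrary extension to split, and its defect
    factors through the submodule as a cocycle. *)
Lemma Ext1_eq0P (d e : dimvec N) (x : Lambda k d) (y : Lambda k e) :
  Ext1_eq0 x y <->
  (forall al be, cocycle (lamT x) (lamB x) (lamT y) (lamB y) al be ->
                 coboundary (lamT x) (lamB x) (lamT y) (lamB y) al be).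
Proof.
split=> [ext al be co|ex c z f g [[fT fB] [gT gB] ses]].
  pose zT v := block_mx (lamT x v) (al v) 0 (lamT y v).
  pose zB v := block_mx (lamB x v) (be v) 0 (lamB y v).
  have zrel v : zB v *m zT v = zT v.+1 *m zB v.+1.
    rewrite /zB /zT !mulmx_block !mul0mx !mulmx0 !addr0 !add0r !lam_rel.
    by congr block_mx; apply/eqP; rewrite -subr_eq0; apply/eqP; exact: co.
  pose z := @LambdaPoint k N (dimvecD d e) zT zB zrel.
  pose f v : 'M[k]_(e v, dimvecD d e v) := row_mx 0 1%:M.
  pose g v : 'M[k]_(dimvecD d e v, d v) := col_mx 1%:M 0.
  have xyz : is_extension x y z f g.
    split.
    - by split=> v; rewrite /f /= /zT /zB mul_row_block mul_mx_row
        !(mul0mx, mulmx0, mulmx1, mul1mx, add0r).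
    - by split=> v; rewrite /g /= /zT /zB mul_block_col mul_col_mx
        !(mul0mx, mulmx0, mulmx1, mul1mx, addr0).
    - move=> v.
      have fg0 : f v *m g v = 0 by rewrite /f /g mul_row_col mul0mx mulmx0 addr0.
      split.
      + by apply/row_freeP; exists (col_mx 0 1%:M); rewrite mul_row_col mul0mx mul1mx add0r.
      + by apply/row_fullP; exists (row_mx 1%:M 0); rewrite mul_row_col mul0mx mul1mx addr0.
      + apply/andP; split; first by apply/sub_kermxP.
        apply/rV_subP=> u /sub_kermxP; rewrite /g -[u]hsubmxK mul_row_col mulmx1 mulmx0 addr0.
        move=> ->; apply/submxP; exists (rsubmx u).
        by rewrite /f mul_mx_row mulmx0 mulmx1.
  have [s [[sT sB] sg]] := ext _ z f g xyz.
  pose h v : 'M[k]_(d v, e v) := rsubmx (s v).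
  have sE v : s v = row_mx 1%:M (h v).
    rewrite -[s v]hsubmxK; congr row_mx.
    by rewrite -(sg v) /g -[s v in RHS]hsubmxK mul_row_col mulmx1 mulmx0 addr0.
  exists h; split=> v.
    have := sT v; rewrite !sE /= /zT mul_mx_row mul_row_block mulmx1 mul1mx => /eq_row_mx[_].
    by rewrite mul1mx /cobT => ->; rewrite addrK.
  have := sB v; rewrite !sE /= /zB mul_mx_row mul_row_block mulmx1 mul1mx => /eq_row_mx[_].
  by rewrite mul1mx /cobB => ->; rewrite addrK.
have free v : row_free (f v) by have [] := ses v.
have full v : row_full (g v) by have [] := ses v.
have ker v : (f v :=: kermx (g v))%MS by have [_ _ /eqmxP] := ses v.
have fg0 v : f v *m g v = 0 by apply/sub_kermxP; rewrite (ker v).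
have [s0 s0g] : exists s0 : cochain0 k d c, forall v, s0 v *m g v = 1%:M.
  by exists (fun v => pinvmx (g v)) => v; apply: mulVpmx.
pose a : cochainT k d c := cobT (lamT x) (lamT z) s0.
pose b : cochainB k d c := cobB (lamB x) (lamB z) s0.
have [al alf] : exists al : cochainT k d e, forall v, al v *m f v.+1 = a v.
  exists (fun v => a v *m pinvmx (f v.+1)) => v.
  apply: mulmxKpV; rewrite (ker v.+1); apply/sub_kermxP.
  by rewrite /a /cobT mulmxBl -!mulmxA gT s0g (mulmxA (s0 v)) s0g mul1mx mulmx1 subrr.
have [be bef] : exists be : cochainB k d e, forall v, be v *m f v = b v.
  exists (fun v => b v *m pinvmx (f v)) => v.
  apply: mulmxKpV; rewrite (ker v); apply/sub_kermxP.
  by rewrite /b /cobB mulmxBl -!mulmxA gB s0g (mulmxA (s0 v.+1)) s0g mul1mx mulmx1 subrr.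
have [|h [alE beE]] := ex al be.
  move=> v; apply: (row_free_inj (free v.+1)); rewrite mul0mx.
  rewrite mulmxBl !mulmxDl -!mulmxA alf bef fT fB !mulmxA alf bef.
  by apply: coboundary_cocycle; exists s0.
exists (fun v => s0 v - h v *m f v); split=> [|v]; last first.
  by rewrite mulmxBl s0g -mulmxA fg0 mulmx0 subr0.
have exchange r s (X Y Z W : 'M[k]_(r, s)) : Y - W = X - Z -> X - Y = Z - W.
  by move/eqP; rewrite subr_eq => /eqP->; rewrite opprD addrA subKr.
split=> v; rewrite mulmxBr mulmxBl; apply: exchange; rewrite -mulmxA.
  by rewrite -fT !mulmxA -mulmxBl -[LHS]/(cobT _ _ h v *m _) -alE alf.
by rewrite -fB !mulmxA -mulmxBl -[LHS]/(cobB _ _ h v *m _) -beE bef.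
Qed.

End ExtensionGroup.

(** * Vanishing of extensions as a pair of surjectivity statements *)

Section ExtBracket.
Variables (k : closedFieldType) (N : nat).

Lemma trace_telescope (d : dimvec N) (M : forall v, 'M[k]_(d v)) :
  \sum_(v < N.+1) (\tr (M v.+1) - \tr (M v)) = 0.
Proof.
rewrite -(big_mkord xpredT (fun v => \tr (M v.+1) - \tr (M v))).
have M0 : M 0%N = 0 by apply: eq_mx_rows0; apply: dimv_supp.
have MN : M N.+1 = 0 by apply: eq_mx_rows0; apply: dimv_gt.
by rewrite telescope_sumr // M0 MN !mxtrace0 subrr.
Qed.

Lemma coboundary_bracket (d e : dimvec N) (x : Lambda k d) (y : Lambda k e) be :
    coboundary (lamT x) (lamB x) (lamT y) (lamB y) (fun=> 0) be ->
  exists2 h : cochain0 k d e,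
    forall v, lamT x v *m h v.+1 = h v *m lamT y v &
    forall v, be v = h v.+1 *m lamB y v - lamB x v *m h v.
Proof.
case=> h [hT hB]; exists (fun v => - h v) => v.
  by apply/eqP; rewrite mulmxN mulNmx eqr_opp -subr_eq0 -[_ - _]/(cobT _ _ h v) -hT.
by rewrite hB mulmxN mulNmx opprK addrC.
Qed.

(** The maps be with al = 0 are the part of a cocycle seen by the surjectivity for
    (x, y).  The other part, the class of al among the extensions of
    T-representations, is dual to the surjectivity for (y, x). *)
Lemma Ext1_eq0_bracket (d e : dimvec N) (x : Lambda k d) (y : Lambda k e) :
  Ext1_eq0 x y <-> bracket_surjective x y /\ bracket_surjective y x.
Proof.
rewrite Ext1_eq0P; split=> [ex|[xy yx] al be co].
  split=> be commute; apply: coboundary_bracket.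
    apply: ex => v; rewrite /cocycle_defect mulmx0 mul0mx add0r addr0.
    by rewrite commute subrr.
  apply: coboundary_dual => al' be' /ex[h [al'E _]].
  rewrite -[RHS](trace_telescope (fun v => - (lamT y v *m be v *m h v))).
  apply: eq_bigr => v _; rewrite mul0mx mxtrace0 sub0r al'E /cobT.
  rewrite mulmxBr !linearN linearB /= !mulmxA commute [\tr (be v *m _ *m _)]mxtrace_mulC !mulmxA.
  by rewrite opprB opprK addrC.
(* first the part al of the cocycle, by duality on the quiver alone *)
have [h hE] : exists h : cochain0 k d e, forall v, al v = cobT (lamT x) (lamT y) h v.
  have [|h [hT _]] := @coboundary_dual _ _ _ _ (lamT x) (fun=> 0) (lamT y) (fun=> 0) al (fun=> 0).
    move=> al' be' co'.
    have [v|g gT gB] := yx be'.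
      have := co' v; rewrite /cocycle_defect mul0mx mulmx0 add0r addr0.
      by move/eqP; rewrite subr_eq0 => /eqP.
    rewrite -[RHS](trace_telescope (fun v => al v *m lamB y v *m g v + lamT x v *m be v *m g v)).
    apply: eq_bigr => v _; rewrite mul0mx mxtrace0 subr0 gB.
    rewrite mulmxBr linearB /= mulmxA mxtrace_mulC mulmxA.
    have -> : lamB x v *m al v = lamT x v.+1 *m be v.+1 + al v.+1 *m lamB y v.+1 - be v *m lamT y v.
      by have /eqP := co v; rewrite subr_eq0 => /eqP<-; rewrite addrK.
    rewrite mulmxBl mulmxDl -[be v *m lamT y v *m _]mulmxA gT !linearB !linearD /=.
    rewrite (mulmxA (be v)) [\tr (be v *m _ *m _)]mxtrace_mulC !mulmxA.
    by ring.
  by exists h.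
pose cB := cobB (lamB x) (lamB y) h; pose be1 v := be v - cB v.
have [v|g gT gB] := xy be1.
  rewrite /be1 mulmxBl mulmxBr; apply/eqP; rewrite -subr_eq0; apply/eqP.
  have e1 := co v; have e2 : cocycle_defect (lamT x) (lamB x) (lamT y) (lamB y) al cB v = 0.
    apply: coboundary_cocycle; exists h; split=> // w.
  rewrite -[RHS]subr0 -{1}e1 -e2 /cocycle_defect.
  move: (be v *m _) (lamT x v.+1 *m be v.+1) (cB v *m _) (_ *m cB v.+1) => *.
  move: (lamB x v *m _) (al v.+1 *m _) => *.
  by apply/matrixP=> i j; rewrite !mxE; ring.
exists (fun v => h v - g v); split=> v.
  by rewrite hE /cobT mulmxBr mulmxBl gT opprB addrA subrK.
have -> : be v = be1 v + cB v by rewrite subrK.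
rewrite gB /cB /cobB mulmxBr mulmxBl.
move: (h v.+1 *m _) (lamB x v *m h v) (g v.+1 *m _) (lamB x v *m g v) => *.
by apply/matrixP=> i j; rewrite !mxE; ring.
Qed.

End ExtBracket.

(** * Openness of the vanishing of extensions *)

Section RegularFunctions.
Variables (k : fieldType) (N : nat) (d : dimvec N).

Definition regular (f : Lambda k d -> k) := exists P, forall x, f x = peval P x.

Lemma eq_regular f g : (forall x, f x = g x) -> regular g -> regular f.
Proof. by move=> fg [P gP]; exists P => x; rewrite fg. Qed.

Lemma regular_const c : regular (fun=> c).
Proof. by exists c%:MP => x; rewrite /peval mevalC. Qed.

Lemma regularD f g : regular f -> regular g -> regular (fun x => f x + g x).
Proof. by move=> [P fP] [Q gQ]; exists (P + Q) => x; rewrite fP gQ /peval mevalD. Qed.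

Lemma regularM f g : regular f -> regular g -> regular (fun x => f x * g x).
Proof. by move=> [P fP] [Q gQ]; exists (P * Q) => x; rewrite fP gQ /peval mevalM. Qed.

Lemma regular_sum (I : Type) (r : seq I) (F : I -> Lambda k d -> k) :
  (forall i, regular (F i)) -> regular (fun x => \sum_(i <- r) F i x).
Proof.
move=> Freg; elim: r => [|i r IH].
  by apply: eq_regular (regular_const 0) => x; rewrite big_nil.
by apply: eq_regular (regularD (Freg i) IH) => x; rewrite big_cons.
Qed.

Lemma regular_prod (I : Type) (r : seq I) (F : I -> Lambda k d -> k) :
  (forall i, regular (F i)) -> regular (fun x => \prod_(i <- r) F i x).
Proof.
move=> Freg; elim: r => [|i r IH].
  by apply: eq_regular (regular_const 1) => x; rewrite big_nil.
by apply: eq_regular (regularM (Freg i) IH) => x; rewrite big_cons.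
Qed.

Lemma regular_coord (t : Defs.coord d) : regular (fun x => coord_val x t).
Proof. by exists 'X_(enum_rank t) => x; rewrite /peval mevalXU enum_rankK. Qed.

Definition regular_mx r s (F : Lambda k d -> 'M[k]_(r, s)) :=
  forall i j, regular (fun x => F x i j).

Lemma regular_mx_const r s (M : 'M[k]_(r, s)) : regular_mx (fun=> M).
Proof. by move=> i j; apply: regular_const. Qed.

Lemma regular_mxD r s (F G : Lambda k d -> 'M[k]_(r, s)) :
  regular_mx F -> regular_mx G -> regular_mx (fun x => F x + G x).
Proof.
by move=> hF hG i j; apply: eq_regular (regularD (hF i j) (hG i j)) => x; rewrite mxE.
Qed.

Lemma regular_mxN r s (F : Lambda k d -> 'M[k]_(r, s)) :
  regular_mx F -> regular_mx (fun x => - F x).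
Proof.
move=> hF i j; apply: eq_regular (regularM (regular_const (-1)) (hF i j)) => x.
by rewrite mxE mulN1r.
Qed.

Lemma regular_mxM r s t (F : Lambda k d -> 'M[k]_(r, s)) (G : Lambda k d -> 'M[k]_(s, t)) :
  regular_mx F -> regular_mx G -> regular_mx (fun x => F x *m G x).
Proof.
move=> hF hG i j; apply: eq_regular (regular_sum _ (fun l => regularM (hF i l) (hG l j))) => x.
by rewrite mxE.
Qed.

Lemma regular_det r (F : Lambda k d -> 'M[k]_r) :
  regular_mx F -> regular (fun x => \det (F x)).
Proof.
move=> hF; apply: regular_sum => s; apply: regularM; first exact: regular_const.
by apply: regular_prod => i; apply: hF.
Qed.

Lemma regular_row_mx r s t (F : Lambda k d -> 'M[k]_(r, s)) (G : Lambda k d -> 'M[k]_(r, t)) :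
  regular_mx F -> regular_mx G -> regular_mx (fun x => row_mx (F x) (G x)).
Proof.
move=> hF hG i j; rewrite -[j]splitK; case: (split j) => l /=.
  by apply: eq_regular (hF i l) => x; rewrite row_mxEl.
by apply: eq_regular (hG i l) => x; rewrite row_mxEr.
Qed.

Lemma regular_fam_vec n p q (F : Lambda k d -> forall v, 'M[k]_(p v, q v)) :
  (forall v, regular_mx (fun x => F x v)) -> regular_mx (fun x => fam_vec n (F x)).
Proof.
move=> hF i t; apply: eq_regular (hF _ (tagged (enum_val t : fam_index n p q)).1
  (tagged (enum_val t : fam_index n p q)).2) => x.
by rewrite mxE.
Qed.

Lemma regular_lin1_mx r s (F : Lambda k d -> 'rV[k]_r -> 'rV[k]_s) :
  (forall u, regular_mx (fun x => F x u)) -> regular_mx (fun x => lin1_mx (F x)).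
Proof.
by move=> hF i j; apply: eq_regular (hF (delta_mx 0 i) 0 j) => x; rewrite mxE.
Qed.

Lemma regular_lamT v : regular_mx (fun x : Lambda k d => lamT x v).
Proof.
move=> i j; have [leNv|ltvN] := leqP N v.
  exists 0 => x; suff -> : lamT x v = 0 by rewrite mxE /peval meval0.
  by apply: trmx_inj; apply: eq_mx_rows0; apply: dimv_gt.
apply: eq_regular (regular_coord (inl (existT _ (Ordinal ltvN) (i, j)))) => x //.
Qed.

Lemma regular_lamB v : regular_mx (fun x : Lambda k d => lamB x v).
Proof.
move=> i j; have [leNv|ltvN] := leqP N v.
  exists 0 => x; suff -> : lamB x v = 0 by rewrite mxE /peval meval0.
  by apply: eq_mx_rows0; apply: dimv_gt.
apply: eq_regular (regular_coord (inr (existT _ (Ordinal ltvN) (i, j)))) => x //.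
Qed.

(** A polynomial vanishing on S vanishes on its closure. *)
Lemma closure_nonvanishing (S : Lambda k d -> Prop) x0 f :
  Zariski_closure S x0 -> regular f -> f x0 != 0 -> exists2 x, S x & f x != 0.
Proof.
move=> clx [P fP] fx0; apply: NNPP => none; case/eqP: fx0; apply: (clx (fun x => f x = 0)).
  exists (fun Q => Q = P) => x; split=> [fx0 Q ->|h]; first by rewrite -fP.
  by rewrite fP; apply: h.
by move=> y Sy; apply/eqP/negPn/negP => fy; apply: none; exists y.
Qed.

Definition regular_point (e : dimvec N) (X : Lambda k d -> Lambda k e) :=
  forall v, regular_mx (fun x => lamT (X x) v) /\ regular_mx (fun x => lamB (X x) v).

Lemma regular_point_id : regular_point id.
Proof. by move=> v; split; [apply: regular_lamT|apply: regular_lamB]. Qed.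

Lemma regular_point_const e (y : Lambda k e) : regular_point (fun=> y).
Proof. by move=> v; split; apply: regular_mx_const. Qed.

(** A contracting homotopy at x0 remains one, up to an invertible map, wherever
    a determinant that is 1 at x0 does not vanish.  The maps X and Y allow moving one point of the
    pair with the other fixed, or both at once along the diagonal. *)
Lemma Ext1_eq0_open (e e' : dimvec N) (X : Lambda k d -> Lambda k e)
    (Y : Lambda k d -> Lambda k e') (S : Lambda k d -> Prop) x0 :
    regular_point X -> regular_point Y -> Zariski_closure S x0 ->
    Ext1_eq0 (X x0) (Y x0) ->
  exists2 x, S x & Ext1_eq0 (X x) (Y x).
Proof.
move=> rX rY clx0 /Ext1_eq0P/cocycle_coboundaryP/exact_homotopy[S1 [S2 hom]].
pose D1 x := cob_mx (lamT (X x)) (lamB (X x)) (lamT (Y x)) (lamB (Y x)).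
pose D2 x := defect_mx (lamT (X x)) (lamB (X x)) (lamT (Y x)) (lamB (Y x)).
have rXT v : regular_mx (fun x => lamT (X x) v) by have [] := rX v.
have rXB v : regular_mx (fun x => lamB (X x) v) by have [] := rX v.
have rYT v : regular_mx (fun x => lamT (Y x) v) by have [] := rY v.
have rYB v : regular_mx (fun x => lamB (Y x) v) by have [] := rY v.
have rD1 : regular_mx D1.
  apply: regular_lin1_mx => u; apply: regular_row_mx; apply: regular_fam_vec => v.
    apply: regular_mxD; first exact: regular_mxM (rXT v) (regular_mx_const _).
    by apply: regular_mxN; apply: regular_mxM (regular_mx_const _) (rYT v).
  apply: regular_mxD; first exact: regular_mxM (rXB v) (regular_mx_const _).
  by apply: regular_mxN; apply: regular_mxM (regular_mx_const _) (rYB v).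
have rD2 : regular_mx D2.
  apply: regular_lin1_mx => u; apply: regular_fam_vec => v.
  apply: regular_mxD; last apply: regular_mxN; apply: regular_mxD.
  - exact: regular_mxM (rXB v) (regular_mx_const _).
  - exact: regular_mxM (regular_mx_const _) (rYT v).
  - exact: regular_mxM (rXT v.+1) (regular_mx_const _).
  - exact: regular_mxM (regular_mx_const _) (rYB v.+1).
pose f x := \det (S1 *m D1 x + D2 x *m S2).
have [||x Sx fx] := @closure_nonvanishing S x0 f clx0.
- apply: regular_det; apply: regular_mxD.
    by apply: regular_mxM => //; apply: regular_mx_const.
  by apply: regular_mxM => //; apply: regular_mx_const.
- by rewrite /f /D1 /D2 hom det1 oner_neq0.
exists x => //; apply/Ext1_eq0P/cocycle_coboundaryP; apply: (@homotopy_exact _ _ _ _ _ _ S1 S2).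
  exact: cob_defect_mx.
by rewrite unitmxE unitfE.
Qed.

End RegularFunctions.

(** * Components and sub-multisegments *)

Section Components.
Variables (k : closedFieldType) (N : nat) (K : finType) (m : multisegment N K).
Let n := #|K|.
Let m' (i : 'I_n) := m (enum_val i).
Let a i : nat := sbeg (m' i).
Let b i : nat := send (m' i).

(** The total space of the conormal bundle of the orbit of M(mL). *)
Definition conormal (L : finType) (mL : multisegment N L)
    (x : Lambda k (rep_dim (multiseg_rep k mL))) :=
  rep_iso (lamT x) (rep_map (multiseg_rep k mL)).

Lemma conormal_component (L : finType) (mL : multisegment N L) x :
  conormal x -> component k mL x.
Proof. by move=> Sx Z _; apply. Qed.

Lemma rigid_component (L : finType) (mL : multisegment N L) :
  rigid (component k mL) -> exists2 x, conormal (mL := mL) x & Ext1_eq0 x x.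
Proof.
move=> [x [Cx ext]].
exact: (Ext1_eq0_open (@regular_point_id _ _ _) (@regular_point_id _ _ _) Cx ext).
Qed.

(** The two points are moved into the dense subset one at a time. *)
Lemma pseudorigid_component (L : finType) (mL : multisegment N L) :
  pseudorigid (component k mL) ->
  exists x y, [/\ conormal (mL := mL) x, conormal (mL := mL) y & Ext1_eq0 x y].
Proof.
move=> [x [y [Cx Cy ext]]].
have [x' Sx' {}ext] := Ext1_eq0_open (@regular_point_id _ _ _) (regular_point_const _ y) Cx ext.
have [y' Sy' {}ext] := Ext1_eq0_open (regular_point_const _ x') (@regular_point_id _ _ _) Cy ext.
by exists x', y'.
Qed.

Let seg_pos (p : pred 'I_n) i : p i -> (0 < a i <= b i)%N.
Proof. by move=> _; apply: segmentP. Qed.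

Lemma conormal_framed (x : Lambda k (rep_dim (multiseg_rep k m))) : conormal x ->
  exists P Q c, [/\ framed predT a b (lamT x) P Q, supp (seg_lt a b predT) c
                  & forall v, lamB x v = Q v.+1 *m c *m P v].
Proof.
case=> g [gu gT].
have [P [Q fr]] : has_frame m' predT (multiseg_rep k m).
  apply: (@has_frame_multiseg _ _ _ m' K m enum_rank) => [|l|i].
  - exact: enum_rank_inj.
  - by rewrite /m' enum_rankK.
  - by symmetry; apply/codomP; exists (enum_val i); rewrite enum_valK.
have frx := framed_conj gu gT fr.
have [c hc xB] := backward_framed (seg_pos (p := predT)) frx frx (lam_rel x).
by eexists; eexists; exists c; split; [exact: frx| |].
Qed.

Variable I : {set K}.
Let p : pred 'I_n := [pred i | enum_val i \in I].
Let mI := sub_multisegment m I.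

Lemma sub_frame : has_frame m' p (multiseg_rep k mI).
Proof.
apply: (@has_frame_multiseg _ _ _ m' _ mI (fun l => enum_rank (val l))) => [l l'|l|i].
- by move/enum_rank_inj/val_inj.
- by rewrite /m' enum_rankK.
- apply/idP/codomP => [iI|[l ->]]; last by rewrite /p /= enum_rankK; exact: (valP l).
  by exists (exist _ (enum_val i) iI); rewrite /= enum_valK.
Qed.

Definition framed_point d (T : RQ k d) P Q c (fr : framed p a b T P Q)
    (hc : supp (seg_lt a b p) c) : Lambda k d :=
  @LambdaPoint k N d T (fun v => Q v.+1 *m c *m P v)
    (fun v => framed_backward (seg_pos (p := p)) fr fr v hc).

Hypothesis apart : forall i j, i \in I -> j \notin I ->
  sbeg (m i) != sbeg (m j) /\ send (m i) != send (m j).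

(** The index set of the segments is kept and the segments outside I are masked
    by p, so that points over m and over its part at I are compared through
    matrices of the same size. *)
Lemma conormal_restrict (x y : Lambda k (rep_dim (multiseg_rep k m))) P Q c P' Q' c' :
    framed predT a b (lamT x) P Q -> framed predT a b (lamT y) P' Q' ->
    supp (seg_lt a b predT) c -> (forall v, lamB x v = Q v.+1 *m c *m P v) ->
    supp (seg_lt a b predT) c' -> (forall v, lamB y v = Q' v.+1 *m c' *m P' v) ->
    Ext1_eq0 x y ->
  exists x1 y1 : Lambda k (rep_dim (multiseg_rep k mI)),
    [/\ conormal x1, conormal y1, Ext1_eq0 x1 y1 & c = c' -> x1 = y1].
Proof.
move=> frx fry hc xB hc' yB /Ext1_eq0_bracket[].
move/(framed_bracket (seg_pos (p := predT)) frx fry hc xB hc' yB) => s.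
move/(framed_bracket (seg_pos (p := predT)) fry frx hc' yB hc xB) => s'.
have apart' i j : p i -> ~~ p j -> a i != a j /\ b i != b j by apply: apart.
have [c1 [c1' [[h1 h1'] s1 s1' e]]] := surjective_commutator_restrict apart'
  (fun i => leq_ord (sbeg (m' i))) hc hc' s s'.
have [PI [QI fr]] := sub_frame.
have isoI z : lamT z = rep_map (multiseg_rep k mI) -> conormal z.
  rewrite /conormal => ->; exists (fun v => 1%:M); split=> v; first exact: unitmx1.
  by rewrite mulmx1 mul1mx.
have bracketP c2 c2' (h2 : supp (seg_lt a b p) c2) (h2' : supp (seg_lt a b p) c2') :
    bracket_surjective (framed_point fr h2) (framed_point fr h2') <->
    surjective_commutator a b p c2 c2'.
  exact: (@framed_bracket _ _ _ _ _ _ (seg_pos (p := p)) _ _ (framed_point fr h2) (framed_point fr h2') PI QI PI QI).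
(* a single point, because two points with equal maps carry different proofs
   of the relations *)
have [cc'|/eqP ne] := eqVneq c c'.
  exists (framed_point fr h1), (framed_point fr h1); split=> //; try exact: isoI.
  rewrite -(e cc') in s1; apply/Ext1_eq0_bracket.
  by split; apply/bracketP.
exists (framed_point fr h1), (framed_point fr h1'); split=> //; try exact: isoI.
by apply/Ext1_eq0_bracket; split; apply/bracketP.
Qed.

Theorem rigid_sub_multisegment :
  rigid (component k m) -> rigid (component k mI).
Proof.
move=> /rigid_component[x /conormal_framed[P [Q [c [fr hc xB]]]] ext].
have [x1 [y1 [Sx1 _ ext1 e]]] := conormal_restrict fr fr hc xB hc xB ext.
rewrite -(e erefl) in ext1; exists x1; split=> //; exact: conormal_component.
Qed.

Theorem pseudorigid_sub_multisegment :
  pseudorigid (component k m) -> pseudorigid (component k mI).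
Proof.
move=> /pseudorigid_component[x [y []]].
move=> /conormal_framed[P [Q [c [fr hc xB]]]] /conormal_framed[P' [Q' [c' [fr' hc' yB]]]] ext.
have [x1 [y1 [Sx1 Sy1 ext1 _]]] := conormal_restrict fr fr' hc xB hc' yB ext.
by exists x1, y1; split=> //; apply: conormal_component.
Qed.

End Components.

Theorem theorem1p1 (k : closedFieldType) (N : nat) (K : finType)
    (m : multisegment N K) (I J : {set K})
    (hIJ : I :|: J = [set: K]) (hdisj : I :&: J = set0)
    (hbeg : [set sbeg (m i) | i in I] :&: [set sbeg (m j) | j in J] = set0)
    (hend : [set send (m i) | i in I] :&: [set send (m j) | j in J] = set0) :
  (rigid (component k m) ->
     rigid (component k (sub_multisegment m I)) /\
     rigid (component k (sub_multisegment m J))) /\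
  (pseudorigid (component k m) ->
     pseudorigid (component k (sub_multisegment m I)) /\
     pseudorigid (component k (sub_multisegment m J))).
Proof.
have apart i j : i \in I -> j \in J ->
    sbeg (m i) != sbeg (m j) /\ send (m i) != send (m j).
  move=> iI jJ; split; apply/eqP=> e.
    have := in_set0 (sbeg (m i)); rewrite -hbeg inE (imset_f (fun i => sbeg (m i)) iI) /=.
    by rewrite e (imset_f (fun i => sbeg (m i)) jJ).
  have := in_set0 (send (m i)); rewrite -hend inE (imset_f (fun i => send (m i)) iI) /=.
  by rewrite e (imset_f (fun i => send (m i)) jJ).
have cover i : (i \in I) || (i \in J) by rewrite -in_setU hIJ inE.
have apartI i j : i \in I -> j \notin I ->
    sbeg (m i) != sbeg (m j) /\ send (m i) != send (m j).
  by move=> iI jI; apply: apart => //; have := cover j; rewrite (negPf jI).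
have apartJ i j : i \in J -> j \notin J ->
    sbeg (m i) != sbeg (m j) /\ send (m i) != send (m j).
  move=> iJ jJ; rewrite eq_sym [send _ == _]eq_sym.
  by apply: apart => //; have := cover j; rewrite (negPf jJ) orbF.
split=> C; split.
- exact: rigid_sub_multisegment apartI C.
- exact: rigid_sub_multisegment apartJ C.
- exact: pseudorigid_sub_multisegment apartI C.
- exact: pseudorigid_sub_multisegment apartJ C.
Qed.
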